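(* Let $n\ge 3$, let $\mathbb{R}$ be the field of real numbers (so that the real closed fields are exactly the fields $F\equiv\mathbb{R}$), and let $H$ be a group. The following are equivalent: (1) $H\equiv \mathrm{GL}_n(\mathbb{R})$; (2) $H\cong\left(\mathrm{SL}_n(L)\cdot\langle d_1\rangle\right)\times B(H)$, for some field $L\equiv\mathbb{R}$ and some group $B(H)\equiv(\mathbb{R}_+)^\times$, where $(\mathbb{R}_+)^\times$ is the multiplicative group of positive reals.
   Context: $\equiv$ denotes elementary equivalence (language of groups for groups, language of rings for fields). $d_1=\mathrm{diag}(-1,1,\dots,1)$, and $\mathrm{SL}_n(L)\cdot\langle d_1\rangle$ is the subgroup of $\mathrm{GL}_n(L)$ generated by $\mathrm{SL}_n(L)$ and $d_1$. *)

(* Defs.v *)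
From HB Require Import structures.
From mathcomp Require Import all_boot all_order all_algebra all_fingroup.
From mathcomp Require Import boolp classical_sets reals.

Set Implicit Arguments.
Unset Strict Implicit.
Unset Printing Implicit Defensive.

Import Order.TTheory GRing.Theory Num.Theory.

Local Open Scope ring_scope.

(* No relation symbol other than equality: the languages of groups and of
   rings are purely functional. *)
Record signature := Signature { symbol : Type; arity : symbol -> nat }.

Section FirstOrder.
Variable S : signature.

Inductive fo_term : Type :=
| Var of nat
| App (f : symbol S) of 'I_(arity f) -> fo_term.

(* The other connectives are definable, the metatheory being classical. *)
Inductive fo_formula : Type :=
| FEq of fo_term & fo_term
| FFalse
| FImp of fo_formula & fo_formula
| FForall of nat & fo_formula.

Fixpoint term_vars (t : fo_term) : seq nat :=
  match t with
  | Var i => [:: i]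
  | App f ts => flatten [seq term_vars (ts i) | i <- enum 'I_(arity f)]
  end.

Fixpoint free_vars (p : fo_formula) : seq nat :=
  match p with
  | FEq t u => term_vars t ++ term_vars u
  | FFalse => [::]
  | FImp p q => free_vars p ++ free_vars q
  | FForall x p => [seq y <- free_vars p | y != x]
  end.

Definition sentence (p : fo_formula) : Prop := free_vars p = [::].

Record fo_structure := FoStructure {
  carrier : Type;
  interp : forall f : symbol S, ('I_(arity f) -> carrier) -> carrier
}.

Fixpoint eval (M : fo_structure) (e : nat -> carrier M) (t : fo_term)
    : carrier M :=
  match t with
  | Var i => e i
  | App f ts => interp (fun i => eval e (ts i))
  end.

Fixpoint holds (M : fo_structure) (e : nat -> carrier M) (p : fo_formula)
    : Prop :=
  match p with
  | FEq t u => eval e t = eval e u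
  | FFalse => False
  | FImp p q => holds e p -> holds e q
  | FForall x p => forall a : carrier M, holds [eta e with x |-> a] p
  end.

(* For a sentence p and an inhabited M, [holds e p] does not depend on e. *)
Definition models (M : fo_structure) (p : fo_formula) : Prop :=
  forall e : nat -> carrier M, holds e p.

Definition elem_equiv (M N : fo_structure) : Prop :=
  forall p : fo_formula, sentence p -> (models M p <-> models N p).

End FirstOrder.

Variant group_symbol := GOne | GInv | GMul.

Definition group_sig : signature :=
  @Signature group_symbol
    (fun f => match f with GOne => 0 | GInv => 1 | GMul => 2 end)%N.

(* Binary symbols take their arguments at ord0 and ord_max : 'I_2. *)
Definition group_structure (G : groupType) : fo_structure group_sig :=
  @FoStructure group_sig G (fun f =>
    match f return ('I_(@arity group_sig f) -> G) -> G with
    | GOne => fun=> 1%g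
    | GInv => fun a => ((a ord0)^-1)%g
    | GMul => fun a => (a ord0 * a ord_max)%g
    end).

Variant ring_symbol := RZero | ROne | ROpp | RAdd | RMul.

Definition ring_sig : signature :=
  @Signature ring_symbol
    (fun f => match f with
              | RZero => 0 | ROne => 0 | ROpp => 1 | RAdd => 2 | RMul => 2
              end)%N.

Definition ring_structure (K : nzRingType) : fo_structure ring_sig :=
  @FoStructure ring_sig K (fun f =>
    match f return ('I_(@arity ring_sig f) -> K) -> K with
    | RZero => fun=> 0
    | ROne => fun=> 1
    | ROpp => fun a => - a ord0
    | RAdd => fun a => a ord0 + a ord_max
    | RMul => fun a => a ord0 * a ord_max
    end).

Definition group_equiv (G H : groupType) : Prop :=
  elem_equiv (group_structure G) (group_structure H).

Definition field_equiv (K L : fieldType) : Prop :=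
  elem_equiv (ring_structure K) (ring_structure L).

Definition group_iso (G H : groupType) : Prop :=
  exists f : {multiplicative G -> H}, bijective f.

(* The subgroup generated by A, as the intersection of the subgroups
   containing A: <<A>> of fingroup is for finite groups only. *)
Section Generated.
Variables (G : groupType) (A : set G).

Definition gen : {pred G} :=
  [pred x | `[< forall K : {pred G},
                  group_closed K -> (forall y, A y -> y \in K) -> x \in K >]].

Lemma gen_group_closed : group_closed gen.
Proof.
split=> [|x y /asboolP genx /asboolP geny]; apply/asboolP=> K clK AK.
  by have [] := clK.
by apply: (snd clK); [exact: genx | exact: geny].
Qed.

Record gen_group := GenGroup { gen_val : G; _ : gen_val \in gen }.

HB.instance Definition _ := [isSub for gen_val].
HB.instance Definition _ := [Choice of gen_group by <:].
HB.instance Definition _ :=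
  SubChoice_isSubGroup.Build G gen gen_group gen_group_closed.

End Generated.

(* MathComp's {'GL_n[R]} requires a finite ring. *)
Section GeneralLinear.
Variables (n : nat) (F : fieldType).

Record GL := MkGL { GL_mx : 'M[F]_n; _ : GL_mx \in unitmx }.

HB.instance Definition _ := [isSub for GL_mx].
HB.instance Definition _ := [Choice of GL by <:].

Lemma GL_one_subproof : 1%:M \in @unitmx F n.
Proof. exact: unitmx1. Qed.

Lemma GL_inv_subproof (A : GL) : invmx (GL_mx A) \in unitmx.
Proof. by rewrite unitmx_inv; exact: valP A. Qed.

Lemma GL_mul_subproof (A B : GL) : GL_mx A *m GL_mx B \in unitmx.
Proof. by rewrite unitmx_mul (valP A) (valP B). Qed.

Definition GL_one : GL := MkGL GL_one_subproof.
Definition GL_inv (A : GL) : GL := MkGL (GL_inv_subproof A).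
Definition GL_mul (A B : GL) : GL := MkGL (GL_mul_subproof A B).

Lemma GL_mulA : associative GL_mul.
Proof. by move=> A B C; apply: val_inj; rewrite /= mulmxA. Qed.

Lemma GL_mul1 : left_id GL_one GL_mul.
Proof. by move=> A; apply: val_inj; rewrite /= mul1mx. Qed.

Lemma GL_mulr1 : right_id GL_one GL_mul.
Proof. by move=> A; apply: val_inj; rewrite /= mulmx1. Qed.

Lemma GL_mulV : left_inverse GL_one GL_inv GL_mul.
Proof. by move=> A; apply: val_inj; rewrite /= mulVmx // (valP A). Qed.

Lemma GL_mulrV : right_inverse GL_one GL_inv GL_mul.
Proof. by move=> A; apply: val_inj; rewrite /= mulmxV // (valP A). Qed.

HB.instance Definition _ :=
  isGroup.Build GL GL_mulA GL_mul1 GL_mulr1 GL_mulV GL_mulrV.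

Definition SL : set GL := [set A | \det (GL_mx A) = 1].

Definition d1_mx : 'M[F]_n :=
  diag_mx (\row_(j < n) if j == 0%N :> nat then -1 else 1).

Lemma d1_mx_unit : d1_mx \in unitmx.
Proof.
rewrite unitmxE det_diag unitfE; apply/prodf_neq0 => i _; rewrite mxE.
by case: ifP; rewrite ?oppr_eq0 oner_eq0.
Qed.

Definition d1 : GL := MkGL d1_mx_unit.

Definition SL_d1 : groupType := gen_group (SL `|` [set d1])%classic.

End GeneralLinear.

Section PositiveGroup.
Variable R : numFieldType.

Record pos_group := MkPos { pos_val : R; _ : 0 < pos_val }.

HB.instance Definition _ := [isSub for pos_val].
HB.instance Definition _ := [Choice of pos_group by <:].

Lemma pos_inv_subproof (x : pos_group) : 0 < (pos_val x)^-1.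
Proof. by rewrite invr_gt0; exact: valP x. Qed.

Lemma pos_mul_subproof (x y : pos_group) : 0 < pos_val x * pos_val y.
Proof. by rewrite mulr_gt0 ?(valP x) ?(valP y). Qed.

Definition pos_one : pos_group := MkPos ltr01.
Definition pos_inv (x : pos_group) : pos_group := MkPos (pos_inv_subproof x).
Definition pos_mul (x y : pos_group) : pos_group :=
  MkPos (pos_mul_subproof x y).

Lemma pos_mulA : associative pos_mul.
Proof. by move=> x y z; apply: val_inj; rewrite /= mulrA. Qed.

Lemma pos_mul1 : left_id pos_one pos_mul.
Proof. by move=> x; apply: val_inj; rewrite /= mul1r. Qed.

Lemma pos_mulr1 : right_id pos_one pos_mul.
Proof. by move=> x; apply: val_inj; rewrite /= mulr1. Qed.

Lemma pos_mulV : left_inverse pos_one pos_inv pos_mul.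
Proof.
by move=> x; apply: val_inj; rewrite /= mulVf // lt0r_neq0 // (valP x).
Qed.

Lemma pos_mulrV : right_inverse pos_one pos_inv pos_mul.
Proof.
by move=> x; apply: val_inj; rewrite /= mulfV // lt0r_neq0 // (valP x).
Qed.

HB.instance Definition _ :=
  isGroup.Build pos_group pos_mulA pos_mul1 pos_mulr1 pos_mulV pos_mulrV.

End PositiveGroup.

(* Main.v *)
Require Import Defs.
From HB Require Import structures.
From mathcomp Require Import all_boot all_order all_algebra all_fingroup.
From mathcomp Require Import boolp classical_sets reals.

Set Implicit Arguments.
Unset Strict Implicit.
Unset Printing Implicit Defensive.

Import Order.TTheory GRing.Theory Num.Theory.

(** Dividing a real matrix by the positive n-th root of the absolute value of
    its determinant shows that GL_n(R) is the product of SL_n(R).<d_1>, the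
    group of matrices of determinant 1 or -1, and of the positive scalars.
    The first factor is interpreted in the field, an element being coded by its
    entries ([SL_d1_equiv]), and direct products preserve elementary
    equivalence ([elem_equiv_prod]); hence every group
    (SL_n(L).<d_1>) x B as in the statement is elementarily equivalent to
    GL_n(R).

    Conversely, a single sentence, true in GL_n(R), forces a group to be such a
    product. Its parameters stand for the involution d_1, the transvection
    1 + E_01 and, for each pair (i, j), a permutation matrix conjugating E_01
    to E_ij. The double centralizer of d_1 rescales the transvection, so that
    the root subgroup of the matrices 1 + a E_01 is definable; conjugates of it
    give the other root subgroups, and the commutator formula
    [1 + a E_02, 1 + b E_21] = 1 + ab E_01 makes it a field. The sentence says
    that these parameters yield a field ([frame]) and that the group is
    coordinatized by it ([coordinatized]): products of elementary matrices
    along a fixed pattern of positions multiply as the corresponding group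
    elements do, and together with d_1 and the squares of central elements
    these fill the group. A fixed pattern reaches all of SL_n over every field,
    by column reduction ([SL_bounded_generation]); therefore the sentence
    implies the decomposition ([coordinatized_iso]), with L the field on the
    root subgroup and B the group of squares of central elements.

    The factor B inherits its theory from the group, being definable in it
    without parameters. For L this requires that in GL_n(R) the field be that
    of the reals for all parameters satisfying [frame], not only for the
    intended ones, since nothing more is known about the parameters found in an
    arbitrary group. This is a computation with the eigenspaces of the
    involution: the relations force the second parameter to be 1 + N with N
    of square zero mapping one eigenspace into the other and killing the latter
    ([frame_nilpotent]), so that
    the line consists of the matrices 1 + a N ([line_nilpotent]); the
    multiplication is then polynomial and additive in its first argument, hence
    bilinear, hence that of the reals ([real_line]).

    Definability is handled semantically: [definable] says that one formula
    expresses a property throughout a class of structures with named constants,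
    and closure lemmas replace the writing of formulas. *)

(** * First-order formulas: coincidence, renaming, closure, isomorphism *)

Section Formulas.
Variable S : signature.
Implicit Types (M N : fo_structure S) (t : fo_term S) (p : fo_formula S).

Lemma eq_eval M (e e' : nat -> carrier M) t :
  {in term_vars t, e =1 e'} -> eval e t = eval e' t.
Proof.
elim: t => [i|f ts IH] /= ee'; first by rewrite ee' ?inE.
congr interp; apply/funext => i; apply: IH => k kt.
by apply: ee'; apply/flatten_mapP; exists i; rewrite ?mem_enum.
Qed.

Lemma eq_holds M (e e' : nat -> carrier M) p :
  {in free_vars p, e =1 e'} -> holds e p <-> holds e' p.
Proof.
elim: p e e' => [t u|//|p IHp q IHq|x p IHp] e e' /= ee'.
- by rewrite (@eq_eval _ e e' t) ?(@eq_eval _ e e' u) // => k kt;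
    apply: ee'; rewrite mem_cat kt ?orbT.
- by rewrite (IHp e e') ?(IHq e e') // => k kt; apply: ee';
    rewrite mem_cat kt ?orbT.
- have E a : holds [eta e with x |-> a] p <-> holds [eta e' with x |-> a] p.
    apply: IHp => k kp /=; case: eqP => // /eqP kx.
    by rewrite ee' // mem_filter kx.
  by split=> Hp a; apply/E; apply: Hp.
Qed.

Lemma eq_holds_ext M (e e' : nat -> carrier M) p :
  e =1 e' -> holds e p <-> holds e' p.
Proof. by move=> ee'; apply: eq_holds => k _; exact: ee'. Qed.

Fixpoint rename_term (r : nat -> nat) t : fo_term S :=
  match t with
  | Var i => Var S (r i)
  | App f ts => App (fun i => rename_term r (ts i))
  end.

Lemma eval_rename_term M (e : nat -> carrier M) r t :
  eval e (rename_term r t) = eval (fun k => e (r k)) t.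
Proof.
by elim: t => [//|f ts IH] /=; congr interp; apply/funext => i.
Qed.

Lemma bounded_on_seq (r : nat -> nat) (s : seq nat) :
  exists y, forall k, k \in s -> (r k < y)%N.
Proof.
exists (\max_(k <- s) r k).+1 => k ks; rewrite ltnS.
exact: leq_bigmax_seq.
Qed.

(** Bound variables are refreshed above all images of free ones, so that
    [r] may identify variables. *)
Lemma rename_formula p (r : nat -> nat) :
  exists q, forall M (e : nat -> carrier M),
    holds e q <-> holds (fun k => e (r k)) p.
Proof.
elim: p r => [t u|//|p IHp q IHq|x p IHp] r.
- exists (FEq (rename_term r t) (rename_term r u)) => M e /=.
  by rewrite !eval_rename_term.
- by exists (FFalse S).
- have [p' Hp] := IHp r; have [q' Hq] := IHq r.
  by exists (FImp p' q') => M e /=; rewrite Hp Hq.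
have [y Hy] := bounded_on_seq r (free_vars p).
have [p' Hp] := IHp [eta r with x |-> y].
exists (FForall y p') => M e /=.
have E a : holds [eta e with y |-> a] p' <->
           holds [eta (fun k => e (r k)) with x |-> a] p.
  rewrite Hp; apply: eq_holds => k /Hy ky /=.
  by case: (k == x); rewrite ?eqxx // ltn_eqF.
by split=> H a; apply/E; apply: H.
Qed.

Lemma holds_closure_seq M (e : nat -> carrier M) (s : seq nat) p :
  holds e (foldr (@FForall S) p s) <->
  forall e', {in [predC s], e' =1 e} -> holds e' p.
Proof.
elim: s e => [|x s IHs] e /=.
  split=> [H e' ee'|]; last by apply.
  by apply/(eq_holds_ext (e' := e)) => // k; apply: ee'.
split=> [H e' ee'|H a].
  have /IHs := H (e' x); apply => k /= ks.
  by case: eqP => [->//|/eqP kx]; rewrite ee' // inE /= in_cons (negPf kx).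
apply/IHs => e' ee'; apply: H => k; rewrite inE /= in_cons negb_or => /andP[kx ks].
by rewrite ee' //= (negPf kx).
Qed.

(** Quantification over all variables in [b] at once is a finite block of
    quantifiers, over the free variables of [p] that lie in [b]. *)
Lemma closure_formula p (b : pred nat) :
  exists q, forall M (e : nat -> carrier M),
    holds e q <-> forall e', (forall k, ~~ b k -> e' k = e k) -> holds e' p.
Proof.
exists (foldr (@FForall S) p [seq k <- free_vars p | b k]) => M e.
rewrite holds_closure_seq; split=> H e' ee'; last first.
  by apply: H => k bk; apply: ee'; rewrite inE /= mem_filter (negPf bk).
have /H: {in [predC [seq k <- free_vars p | b k]],
           (fun k => if b k && (k \in free_vars p) then e' k else e k) =1 e}.
  by move=> k; rewrite inE /= mem_filter => /negPf ->.
apply: (proj1 (eq_holds _)) => k kp; rewrite kp andbT; case: ifPn => // bk.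
by rewrite ee'.
Qed.

Lemma free_vars_closure_seq (s : seq nat) p :
  free_vars (foldr (@FForall S) p s) = [seq y <- free_vars p | y \notin s].
Proof.
elim: s => [|x s IHs] /=; first by rewrite filter_predT.
by rewrite IHs -filter_predI; apply: eq_filter => y; rewrite /= in_cons negb_or.
Qed.

Lemma universal_closure p :
  exists2 q, sentence q & forall M, models M q <-> models M p.
Proof.
exists (foldr (@FForall S) p (free_vars p)) => [|M].
  rewrite /sentence free_vars_closure_seq.
  by apply/eqP; rewrite -(negbK (_ == _)) -has_filter; apply/hasPn => y ->.
split=> H e; last by apply/holds_closure_seq.
by have /holds_closure_seq := H e; apply.
Qed.

Lemma elem_equiv_models M N p :
  elem_equiv M N -> models M p <-> models N p.
Proof.
move=> MN; have [q sq Hq] := universal_closure p.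
by rewrite -!Hq; exact: MN.
Qed.

Definition FNot p := FImp p (FFalse S).

Lemma elem_equiv_satisfiable M N p :
  elem_equiv M N ->
  (exists e : nat -> carrier M, holds e p) ->
  exists e : nat -> carrier N, holds e p.
Proof.
move=> MN [e ep]; apply: contrapT => noN.
have: models N (FNot p) by move=> e' /= e'p; apply: noN; exists e'.
by move/(elem_equiv_models _ MN)/(_ e)/(_ ep).
Qed.

Lemma sentence_models M (x : carrier M) p :
  sentence p -> models M p \/ models M (FNot p).
Proof.
move=> sp; have E e e' : holds (M := M) e p -> holds (M := M) e' p.
  by apply: (proj1 (eq_holds _)); rewrite sp.
have [Hp|Hp] := pselect (holds (fun=> x) p); [left|right] => e; first exact: E Hp.
by move=> /(E _ (fun=> x)).
Qed.

(** Completeness of the theory of a structure turns one inclusion of theories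
    into an equivalence. *)
Lemma elem_equiv_incl M N (y : carrier N) (x : carrier M) :
  (forall p, sentence p -> models M p -> models N p) -> elem_equiv M N.
Proof.
move=> MN p sp; split; first exact: MN.
move=> Np; have [//|/MN nNp] := sentence_models x sp.
have /nNp /(_ (fun=> y)) []: sentence (FNot p) by rewrite /sentence /= sp.
exact: Np.
Qed.

Lemma elem_equiv_sym M N : elem_equiv M N -> elem_equiv N M.
Proof. by move=> MN p sp; rewrite MN. Qed.

Lemma elem_equiv_trans M N P : elem_equiv M N -> elem_equiv N P -> elem_equiv M P.
Proof. by move=> MN NP p sp; rewrite MN // NP. Qed.

Definition fo_morphism M N (h : carrier M -> carrier N) :=
  forall (f : symbol S) (a : 'I_(arity f) -> carrier M),
    h (interp a) = interp (fun i => h (a i)).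

Lemma eval_morphism M N (h : carrier M -> carrier N) (e : nat -> carrier M) t :
  fo_morphism h -> h (eval e t) = eval (fun k => h (e k)) t.
Proof.
move=> hm; elim: t => [//|f ts IH] /=.
by rewrite hm; congr interp; apply/funext => i.
Qed.

Lemma holds_iso M N (h : carrier M -> carrier N) (e : nat -> carrier M) p :
  fo_morphism h -> bijective h -> holds e p <-> holds (fun k => h (e k)) p.
Proof.
move=> hm [h' hK h'K].
elim: p e => [t u|//|p IHp q IHq|x p IHp] e /=.
- rewrite -!eval_morphism //; split=> [->//|/(can_inj hK)//].
- by rewrite IHp IHq.
have E a : holds [eta e with x |-> a] p <->
    holds [eta (fun k => h (e k)) with x |-> h a] p.
  by rewrite IHp; apply: eq_holds_ext => k /=; case: eqP.
split=> H a; last by apply/E; apply: H.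
by rewrite -(h'K a); apply/E; apply: H.
Qed.

Lemma iso_elem_equiv M N (h : carrier M -> carrier N) :
  fo_morphism h -> bijective h -> elem_equiv M N.
Proof.
move=> hm hb p _; have [h' hK h'K] := hb; split=> H e; last first.
  by rewrite (holds_iso _ _ hm hb).
have /(holds_iso _ _ hm hb) := H (fun k => h' (e k)).
by apply: (proj1 (eq_holds_ext _ _)) => k.
Qed.

End Formulas.

(** * Direct products preserve elementary equivalence *)

Section Product.
Variable S : signature.
Implicit Types (s : seq (fo_formula S * fo_formula S)).

Definition fo_prod (M N : fo_structure S) : fo_structure S :=
  @FoStructure S (carrier M * carrier N) (fun f a =>
    (interp (fun i => (a i).1), interp (fun i => (a i).2))).

Fixpoint holds_dnf (M N : fo_structure S)
    (e : nat -> carrier M) (e' : nat -> carrier N) s : Prop :=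
  if s is pq :: s' then
    (holds e pq.1 /\ holds e' pq.2) \/ holds_dnf e e' s'
  else False.

Lemma holds_dnf_cat (M N : fo_structure S)
    (e : nat -> carrier M) (e' : nat -> carrier N) s s' :
  holds_dnf e e' (s ++ s') <-> holds_dnf e e' s \/ holds_dnf e e' s'.
Proof.
by elim: s => [|pq s IHs] /=; rewrite ?IHs; tauto.
Qed.

Definition FAnd (p q : fo_formula S) := FNot (FImp p (FNot q)).

Lemma holds_FAnd (M : fo_structure S) (e : nat -> carrier M) p q :
  holds e (FAnd p q) <-> holds e p /\ holds e q.
Proof.
by split=> [/= H|[Hp Hq] /=]; [split; apply: contrapT|]; tauto.
Qed.

Definition FTrue := FNot (FFalse S).

(** Negating a disjunction of rectangles: a point misses a rectangle when one
    of its two projections does. *)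
Fixpoint dnf_neg s :=
  if s is pq :: s' then
    [seq (FAnd (FNot pq.1) rs.1, rs.2) | rs <- dnf_neg s'] ++
    [seq (rs.1, FAnd (FNot pq.2) rs.2) | rs <- dnf_neg s']
  else [:: (FTrue, FTrue)].

Lemma holds_dnf_map (M N : fo_structure S)
    (e : nat -> carrier M) (e' : nat -> carrier N) s F (A : Prop) :
  (forall rs, holds e (F rs).1 /\ holds e' (F rs).2 <->
     A /\ (holds e rs.1 /\ holds e' rs.2)) ->
  holds_dnf e e' (map F s) <-> A /\ holds_dnf e e' s.
Proof.
by move=> HF; elim: s => [|pq s IHs] /=; rewrite ?IHs ?HF; tauto.
Qed.

Lemma holds_dnf_neg (M N : fo_structure S)
    (e : nat -> carrier M) (e' : nat -> carrier N) s :
  holds_dnf e e' (dnf_neg s) <-> ~ holds_dnf e e' s.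
Proof.
elim: s => [|[p q] s IHs].
  by rewrite /=; tauto.
rewrite [dnf_neg _]/= holds_dnf_cat.
rewrite (@holds_dnf_map _ _ e e' _ _ (~ holds e p)); last first.
  by move=> rs; have := holds_FAnd e (FNot p) rs.1; rewrite /=; tauto.
rewrite (@holds_dnf_map _ _ e e' _ _ (~ holds e' q)); last first.
  by move=> rs; have := holds_FAnd e' (FNot q) rs.2; rewrite /=; tauto.
rewrite IHs /=; split; first tauto.
move=> H; have [Hp|Hp] := pselect (holds e p); tauto.
Qed.

(** Over a product every formula is, uniformly in both factors, a finite
    disjunction of rectangles; rectangles are stable under projection. *)
Lemma feferman_vaught p :
  exists s, forall (M N : fo_structure S) (e : nat -> carrier (fo_prod M N)),
    holds e p <-> holds_dnf (fun k => (e k).1) (fun k => (e k).2) s.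
Proof.
elim: p => [t u||p [s Hs] q [s' Hs']|x p [s Hs]].
- exists [:: (FEq t u, FEq t u)] => M N e.
  have E v : eval e v = (eval (fun k => (e k).1) v, eval (fun k => (e k).2) v).
    rewrite [eval e v]surjective_pairing.
    by rewrite (@eval_morphism _ (fo_prod M N) M fst) //
               (@eval_morphism _ (fo_prod M N) N snd).
  rewrite /= !E; split=> [[-> ->]|[[-> ->]|]] //; by left.
- by exists [::].
- exists (dnf_neg s ++ s') => M N e /=.
  rewrite holds_dnf_cat holds_dnf_neg -Hs -Hs'.
  by split=> [|[|]]; have [|] := pselect (holds e p); tauto.
have [s' Hs'] : exists s', forall (M N : fo_structure S)
    (e : nat -> carrier M) (e' : nat -> carrier N),
    holds_dnf e e' s' <-> exists a b,
      ~ holds_dnf [eta e with x |-> a] [eta e' with x |-> b] s.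
  pose F (pq : fo_formula S * fo_formula S) :=
    (FNot (FForall x (FNot pq.1)), FNot (FForall x (FNot pq.2))).
  exists (map F (dnf_neg s)) => M N e e'.
  have {}E : holds_dnf e e' (map F (dnf_neg s)) <-> exists a b,
      holds_dnf [eta e with x |-> a] [eta e' with x |-> b] (dnf_neg s).
    elim: (dnf_neg s) => [|[p1 p2] s' IHs] /=; first by split=> [|[a [b]]].
    rewrite IHs /=; split.
      case=> [[H1 H2]|[a [b H]]]; last first.
        by exists a, b; right.
      have [a Ha] : exists a, holds [eta e with x |-> a] p1.
        by apply: contrapT => no; apply: H1 => a Ha; apply: no; exists a.
      have [b Hb] : exists b, holds [eta e' with x |-> b] p2.
        by apply: contrapT => no; apply: H2 => b Hb; apply: no; exists b.
      by exists a, b; left.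
    case=> a [b [[H1 H2]|H]]; last by right; exists a, b.
    by left; split=> H; [apply: (H a)|apply: (H b)].
  rewrite E; split=> -[a [b H]]; exists a, b; exact/holds_dnf_neg.
exists (dnf_neg s') => M N e; rewrite holds_dnf_neg Hs' /=.
have E a : holds [eta e with x |-> a] p <->
    holds_dnf [eta (fun k => (e k).1) with x |-> a.1]
              [eta (fun k => (e k).2) with x |-> a.2] s.
  rewrite Hs.
  have -> : (fun k => ([eta e with x |-> a] k).1) =
            [eta (fun k => (e k).1) with x |-> a.1].
    by apply/funext => k /=; case: eqP.
  have -> // : (fun k => ([eta e with x |-> a] k).2) =
            [eta (fun k => (e k).2) with x |-> a.2].
    by apply/funext => k /=; case: eqP.
split=> [H [a [b]]|H a]; first by apply; apply/(E (a, b)).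
by apply/E; apply: contrapT => Ha; apply: H; exists a.1, a.2.
Qed.

Lemma satisfiable_dnf (M N M' N' : fo_structure S) s :
  elem_equiv M M' -> elem_equiv N N' ->
  (exists (e : nat -> carrier M) (e' : nat -> carrier N), holds_dnf e e' s) ->
  exists (f : nat -> carrier M') (f' : nat -> carrier N'), holds_dnf f f' s.
Proof.
move=> MM NN [e [e']]; elim: s => [//|[p q] s IHs] /= [[He He']|/IHs].
  have [f Hf] := elem_equiv_satisfiable MM (ex_intro _ e He).
  have [f' Hf'] := elem_equiv_satisfiable NN (ex_intro _ e' He').
  by exists f, f'; left.
by case=> f [f' Hff']; exists f, f'; right.
Qed.

Lemma elem_equiv_prod (M N M' N' : fo_structure S) :
  elem_equiv M M' -> elem_equiv N N' ->
  elem_equiv (fo_prod M N) (fo_prod M' N').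
Proof.
have half (A B A' B' : fo_structure S) p : elem_equiv A A' -> elem_equiv B B' ->
    models (fo_prod A' B') p -> models (fo_prod A B) p.
  move=> AA BB Hp e; apply: contrapT.
  have [s Hs] := feferman_vaught p.
  rewrite Hs -holds_dnf_neg => Hneg.
  have [|f [f']] := @satisfiable_dnf _ _ _ _ (dnf_neg s) AA BB.
    by exists (fun k => (e k).1), (fun k => (e k).2).
  by rewrite holds_dnf_neg; apply; apply/(Hs _ _ (fun k => (f k, f' k))).
move=> MM NN p _; split; apply: half => //; exact: elem_equiv_sym.
Qed.

End Product.

(** * Uniform definability over a class of structures with constants *)

(** Constants sit at the even variables and the environment at the odd ones; the
    same interleaving merges an environment with a sequence under a quantifier. *)
Definition mix (T : Type) (a b : nat -> T) (k : nat) : T :=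
  if odd k then b k./2 else a k./2.

Definition evens (T : Type) (e : nat -> T) (k : nat) : T := e k.*2.
Definition odds (T : Type) (e : nat -> T) (k : nat) : T := e k.*2.+1.

Lemma evens_mix (T : Type) (a b : nat -> T) : evens (mix a b) = a.
Proof. by apply/funext => k; rewrite /evens /mix odd_double doubleK. Qed.

Lemma odds_mix (T : Type) (a b : nat -> T) : odds (mix a b) = b.
Proof.
by apply/funext => k; rewrite /odds /mix /= odd_double /= uphalf_double.
Qed.

Lemma mix_evens_odds (T : Type) (e : nat -> T) : mix (evens e) (odds e) = e.
Proof.
apply/funext => k; rewrite /mix /evens /odds.
by case: ifP => ok; congr e; rewrite -[RHS]odd_double_half ok.
Qed.

Section Definability.
Variables (S : signature) (C : Type) (M : C -> fo_structure S).
Variable g : forall c, nat -> carrier (M c).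

Notation env c := (nat -> carrier (M c)).

Definition definable (P : forall c, env c -> Prop) :=
  exists p, forall c (e : env c), holds (mix (g c) e) p <-> P c e.

Lemma def_ext (P Q : forall c, env c -> Prop) :
  definable P -> (forall c e, P c e <-> Q c e) -> definable Q.
Proof. by move=> [p Hp] PQ; exists p => c e; rewrite Hp. Qed.

(** Every reindexing of the environment preserves definability, so that contexts
    need no bookkeeping beyond functions on the natural numbers. *)
Lemma def_sub (r : nat -> nat) (P : forall c, env c -> Prop) :
  definable P -> definable (fun c e => P c (fun k => e (r k))).
Proof.
move=> [p Hp].
have [q Hq] := rename_formula p (fun k => if odd k then (r k./2).*2.+1 else k).
exists q => c e; rewrite Hq -Hp; apply: eq_holds_ext => k.
rewrite /mix; case ok: (odd k); last by rewrite ok.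
by rewrite /= odd_double /= uphalf_double.
Qed.

Lemma def_false : definable (fun _ _ => False).
Proof. by exists (FFalse S). Qed.

Lemma def_imp (P Q : forall c, env c -> Prop) :
  definable P -> definable Q -> definable (fun c e => P c e -> Q c e).
Proof. by move=> [p Hp] [q Hq]; exists (FImp p q) => c e /=; rewrite Hp Hq. Qed.

Lemma def_not (P : forall c, env c -> Prop) :
  definable P -> definable (fun c e => ~ P c e).
Proof. by move=> dP; apply: def_imp => //; exact: def_false. Qed.

Lemma def_true : definable (fun _ _ => True).
Proof. by apply: (def_ext (def_not def_false)) => c e; tauto. Qed.

Lemma def_and (P Q : forall c, env c -> Prop) :
  definable P -> definable Q -> definable (fun c e => P c e /\ Q c e).
Proof.
move=> dP dQ; apply: (def_ext (def_not (def_imp dP (def_not dQ)))) => c e.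
by split=> [H|]; [split; apply: contrapT|]; tauto.
Qed.

Lemma def_or (P Q : forall c, env c -> Prop) :
  definable P -> definable Q -> definable (fun c e => P c e \/ Q c e).
Proof.
move=> dP dQ; apply: (def_ext (def_imp (def_not dP) dQ)) => c e.
by have [|] := pselect (P c e); tauto.
Qed.

Lemma def_iff (P Q : forall c, env c -> Prop) :
  definable P -> definable Q -> definable (fun c e => P c e <-> Q c e).
Proof. by move=> dP dQ; apply: def_and; apply: def_imp. Qed.

Lemma def_forall_fin (I : finType) (P : I -> forall c, env c -> Prop) :
  (forall i, definable (P i)) -> definable (fun c e => forall i, P i c e).
Proof.
move=> dP.
have D (s : seq I) : definable (fun c e => forall i, i \in s -> P i c e).
  elim: s => [|j s IHs]; first by apply: (def_ext def_true) => c e; split.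
  apply: (def_ext (def_and (dP j) IHs)) => c e; split=> [[Hj Hs] i|H].
    by rewrite in_cons => /orP[/eqP->|/Hs].
  by split=> [|i is_]; apply: H; rewrite in_cons ?eqxx ?is_ ?orbT.
apply: (def_ext (D (enum I))) => c e; split=> H i; last by move=> _; exact: H.
by apply: H; rewrite mem_enum.
Qed.

(** A formula has finitely many free variables, so that a quantifier over
    infinite sequences amounts to finitely many first-order ones. *)
Lemma def_forall (Q : forall c, env c -> env c -> Prop) :
  definable (fun c e => Q c (evens e) (odds e)) ->
  definable (fun c e => forall s : env c, Q c e s).
Proof.
move=> [p Hp].
have [q Hq] := closure_formula p (fun k => odd k && odd k./2).
have [q' Hq'] := rename_formula q
  (fun k => if odd k && ~~ odd k./2 then k./2./2.*2.+1 else if odd k then 0%N else k).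
(* in [mix (g c) (mix e s)] the sequence [s] occupies the variables 4j + 3 *)
exists q' => c e; rewrite Hq' Hq; split=> [H s|H e' He'].
  have := Hp c (mix e s); rewrite evens_mix odds_mix => <-.
  apply: H => k bk.
  rewrite /mix; case ok: (odd k); move: bk; rewrite ok //= => bk.
  by rewrite (negPf bk) /= odd_double /= uphalf_double.
have E k : ~~ (odd k && odd k./2) -> e' k = mix (g c) (mix e (odds (odds e'))) k.
  move=> bk; rewrite He' // /mix; case ok: (odd k); move: bk; rewrite ok //= => bk.
  by rewrite (negPf bk) /= odd_double /= uphalf_double.
have := H (odds (odds e')).
have := Hp c (mix e (odds (odds e'))); rewrite evens_mix odds_mix => <-.
apply: (proj1 (eq_holds_ext _ _)) => k.
case bk: (odd k && odd k./2); last by rewrite E ?bk.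
case/andP: bk => ok okk; rewrite /mix ok okk /odds; congr e'.
rewrite -[RHS]odd_double_half ok add1n; congr _.*2.+1.
by rewrite -[RHS]odd_double_half okk add1n.
Qed.

Lemma def_exists (Q : forall c, env c -> env c -> Prop) :
  definable (fun c e => Q c (evens e) (odds e)) ->
  definable (fun c e => exists s : env c, Q c e s).
Proof.
move=> dQ; apply: (def_ext (def_not (def_forall
  (Q := fun c e s => ~ Q c e s) (def_not dQ)))) => c e.
split=> [H|[s Hs] H]; last exact: (H s).
by apply: contrapT => no; apply: H => s Hs; apply: no; exists s.
Qed.

Lemma def_eq_var i j : definable (fun c e => e i = e j).
Proof.
exists (FEq (Var S i.*2.+1) (Var S j.*2.+1)) => c e /=.
by rewrite /mix /= !odd_double /= !uphalf_double.
Qed.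

Lemma def_eq_cst i j : definable (fun c e => g c i = e j).
Proof.
exists (FEq (Var S i.*2) (Var S j.*2.+1)) => c e /=.
by rewrite /mix /= !odd_double /= uphalf_double doubleK.
Qed.

Lemma def_eq_app (f : symbol S) (r : 'I_(arity f) -> nat) j :
  definable (fun c e => interp (fun i => e (r i)) = e j).
Proof.
exists (FEq (App (fun i => Var S (r i).*2.+1)) (Var S j.*2.+1)) => c e /=.
have -> : mix (g c) e j.*2.+1 = e j.
  by rewrite /mix /= !odd_double /= uphalf_double.
have -> // : (fun i => mix (g c) e (r i).*2.+1) = (fun i => e (r i)).
by apply/funext => i; rewrite /mix /= !odd_double /= uphalf_double.
Qed.

(** Interpreted objects: every object is the value of a code, a sequence of
    elements, and it is definable when two codes have the same value. *)
Record obj_sort := ObjSort {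
  obj : C -> Type;
  dec : forall c, env c -> obj c;
  dec_surj : forall c (x : obj c), exists s, dec s = x;
  dec_eq : definable (fun c e => dec (evens e) = dec (odds e))
}.

Definition fdef (s : obj_sort) (f : forall c, env c -> obj s c) :=
  definable (fun c e => f c (evens e) = dec s (odds e)).

Section Sorts.
Variable s : obj_sort.

Lemma fdef_sub r (f : forall c, env c -> obj s c) :
  fdef f -> fdef (fun c e => f c (fun k => e (r k))).
Proof.
move=> df; apply: (def_ext (def_sub
  (fun k => if odd k then k else (r k./2).*2) df)) => c e.
have -> : evens (fun k => e (if odd k then k else (r k./2).*2)) =
          fun k => evens e (r k).
  by apply/funext => k; rewrite /evens odd_double doubleK.
have -> // : odds (fun k => e (if odd k then k else (r k./2).*2)) = odds e.
by apply/funext => k; rewrite /odds /= odd_double.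
Qed.

Lemma fdef_dec r : fdef (s := s) (fun c e => dec s (fun k => e (r k))).
Proof.
apply: (def_ext (def_sub (fun k => if odd k then k else (r k./2).*2)
  (dec_eq s))) => c e.
have -> : evens (fun k => e (if odd k then k else (r k./2).*2)) =
          fun k => evens e (r k).
  by apply/funext => k; rewrite /evens odd_double doubleK.
have -> // : odds (fun k => e (if odd k then k else (r k./2).*2)) = odds e.
by apply/funext => k; rewrite /odds /= odd_double.
Qed.

Lemma def_all (Q : forall c, env c -> obj s c -> Prop) :
  definable (fun c e => Q c (evens e) (dec s (odds e))) ->
  definable (fun c e => forall x, Q c e x).
Proof.
move=> dQ; apply: (def_ext (def_forall (Q := fun c e t => Q c e (dec s t)) dQ)).
move=> c e; split=> [H x|H t //].
by have [t <-] := dec_surj x.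
Qed.

Lemma def_ex (Q : forall c, env c -> obj s c -> Prop) :
  definable (fun c e => Q c (evens e) (dec s (odds e))) ->
  definable (fun c e => exists x, Q c e x).
Proof.
move=> dQ; apply: (def_ext (def_not (def_all (Q := fun c e x => ~ Q c e x)
  (def_not dQ)))) => c e.
split=> [H|[x Hx] H]; last exact: (H x).
by apply: contrapT => no; apply: H => x Hx; apply: no; exists x.
Qed.

(** Composition goes through a code of the intermediate value. *)
Lemma def_comp (Q : forall c, env c -> obj s c -> Prop)
    (f : forall c, env c -> obj s c) :
  definable (fun c e => Q c (evens e) (dec s (odds e))) -> fdef f ->
  definable (fun c e => Q c e (f c e)).
Proof.
move=> dQ df; apply: (def_ext (def_exists
  (Q := fun c e t => f c e = dec s t /\ Q c e (dec s t)) (def_and df dQ))).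
move=> c e; split=> [[t [-> //]]|H].
by have [t ft] := dec_surj (f c e); exists t; rewrite ft.
Qed.

Lemma def_eq (f f' : forall c, env c -> obj s c) :
  fdef f -> fdef f' -> definable (fun c e => f c e = f' c e).
Proof.
move=> df df'; apply: (def_comp (Q := fun c e x => f c e = x)) df'.
exact: df.
Qed.

(** A code splits into countably many codes, through [pickle]. *)
Definition block (T : Type) (e : nat -> T) (k j : nat) : T := e (pickle (k, j)).

Definition decs c (e : env c) (k : nat) : obj s c := dec s (block e k).

Lemma block_surj (T : Type) (u : nat -> nat -> T) : exists e, block e = u.
Proof.
exists (fun m => let kj := odflt (0%N, 0%N) (unpickle m) in u kj.1 kj.2).
by apply/funext => k; apply/funext => j; rewrite /block pickleK.
Qed.

Lemma decs_surj c (u : nat -> obj s c) : exists e, decs e = u.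
Proof.
have [t Ht] := choice (fun k => dec_surj (u k)).
have [e He] := block_surj t; exists e; apply/funext => k.
by rewrite /decs He Ht.
Qed.

Lemma def_all_seq (Q : forall c, env c -> (nat -> obj s c) -> Prop) :
  definable (fun c e => Q c (evens e) (decs (odds e))) ->
  definable (fun c e => forall u, Q c e u).
Proof.
move=> dQ; apply: (def_ext (def_forall (Q := fun c e t => Q c e (decs t)) dQ)).
move=> c e; split=> [H u|H t //].
by have [t <-] := decs_surj u.
Qed.

Lemma def_ex_seq (Q : forall c, env c -> (nat -> obj s c) -> Prop) :
  definable (fun c e => Q c (evens e) (decs (odds e))) ->
  definable (fun c e => exists u, Q c e u).
Proof.
move=> dQ; apply: (def_ext (def_not (def_all_seq (Q := fun c e x => ~ Q c e x)
  (def_not dQ)))) => c e.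
split=> [H|[x Hx] H]; last exact: (H x).
by apply: contrapT => no; apply: H => x Hx; apply: no; exists x.
Qed.

End Sorts.

Section Interpretation.
Variables (s : obj_sort) (T : signature).
Variable I : forall c (f : symbol T), ('I_(arity f) -> obj s c) -> obj s c.
Hypothesis def_I : forall (f : symbol T)
    (fs : 'I_(arity f) -> forall c, env c -> obj s c),
  (forall i, fdef (fs i)) -> fdef (fun c e => I (fun i => fs i c e)).

Definition interpreted c : fo_structure T := FoStructure (@I c).

Lemma fdef_eval (t : fo_term T) :
  fdef (s := s) (fun c e => @eval _ (interpreted c) (decs s e) t).
Proof.
elim: t => [k|f ts IH] /=; first exact: fdef_dec.
exact: (def_I (fs := fun i c e => @eval _ (interpreted c) (decs s e) (ts i)) IH).
Qed.

Lemma def_holds (p : fo_formula T) :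
  definable (fun c e => @holds _ (interpreted c) (decs s e) p).
Proof.
elim: p => [t u||p IHp q IHq|x p IHp] /=.
- exact: (def_eq (s := s) (fdef_eval t) (fdef_eval u)).
- exact: def_false.
- exact: def_imp.
apply: (def_all (s := s)
  (Q := fun c e a => @holds _ (interpreted c) [eta decs s e with x |-> a] p)).
pose r m := let kj := odflt (0%N, 0%N) (unpickle m) in
  if kj.1 == x then kj.2.*2.+1 else (pickle kj).*2.
apply: (def_ext (def_sub r IHp)) => c e; apply: eq_holds_ext => k /=.
rewrite /decs /block; case: eqP => [->|/eqP kx]; congr dec; apply/funext => j.
  by rewrite /r pickleK /= eqxx.
by rewrite /r pickleK /= (negPf kx).
Qed.

(** The theory of the interpreted structure is definable, so it only depends
    on the theory of the interpreting one. *)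
Lemma def_models (p : fo_formula T) :
  definable (fun c _ => models (interpreted c) p).
Proof.
apply: (def_ext (def_all_seq (s := s) (Q := fun c e u =>
  @holds _ (interpreted c) u p) _)) => //.
by apply: (def_ext (def_sub (fun k => k.*2.+1) (def_holds p))) => c e.
Qed.

End Interpretation.

(** ** Elements as a sort *)

Definition elem_obj c := carrier (M c).
Definition elem_dec c (e : env c) : elem_obj c := e 0%N.

Lemma elem_dec_surj c (x : elem_obj c) : exists s, elem_dec s = x.
Proof. by exists (fun=> x). Qed.

Definition elem_sort : obj_sort :=
  @ObjSort elem_obj elem_dec elem_dec_surj (def_eq_var _ _).

Definition edef (f : forall c, env c -> carrier (M c)) := fdef (s := elem_sort) f.

Lemma edef_var r : edef (fun c e => e r).
Proof. exact: def_eq_var. Qed.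

Lemma edef_cst k : edef (fun c e => g c k).
Proof. exact: def_eq_cst. Qed.

Lemma edef_app (f : symbol S) (fs : 'I_(arity f) -> forall c, env c -> carrier (M c)) :
  (forall i, edef (fs i)) -> edef (fun c e => interp (fun i => fs i c e)).
Proof.
move=> dfs; apply: (def_ext (def_exists (Q := fun c e t =>
    (forall i, fs i c (evens e) = t (val i)) /\
    interp (fun i : 'I_(arity f) => t (val i)) = odds e 0%N) _)).
  apply: def_and; last exact: (def_eq_app (f := f) (fun i => (val i).*2.+1)).
  apply: def_forall_fin => i.
  apply: (def_ext (def_sub
    (fun k => if odd k then (val i).*2.+1 else k.*2) (dfs i))) => c e /=.
  have -> // : evens (fun k => e (if odd k then (val i).*2.+1 else k.*2)) =
    evens (evens e).
  by apply/funext => k; rewrite /evens odd_double.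
move=> c e; split=> [[t [Ht Hi]]|H].
  by rewrite -[RHS]Hi; congr interp; apply/funext => i.
exists (fun k => if insub k is Some i then fs i c (evens e) else odds e 0%N).
have E (i : 'I_(arity f)) :
    fs i c (evens e) = (if insub (val i) is Some i then fs i c (evens e) else odds e 0%N).
  by rewrite valK.
split=> //; rewrite -[RHS]H; congr interp; apply/funext => i; exact/esym/E.
Qed.

(** ** Objects with finitely many coordinates *)

Section Coordinates.
Variables (N : C -> Type) (K : finType).
Variable coord : forall c, N c -> K -> carrier (M c).
Variable default : forall c, N c.

(** Only finitely many entries of a code matter; a code that is not the list of
    coordinates of an object decodes to [default], which makes decoding total. *)
Definition on_coords c (e : env c) :=
  exists x : N c, forall k, coord x k = e (enum_rank k).

Definition coord_dec c (e : env c) : N c :=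
  if pselect (on_coords e) is left h then projT1 (cid h) else default c.

Lemma coord_decE c (e : env c) k :
  coord (coord_dec e) k =
  if `[< on_coords e >] then e (enum_rank k) else coord (default c) k.
Proof.
rewrite /coord_dec; case: pselect => h; last by rewrite asboolF.
by rewrite asboolT //; case: cid.
Qed.

Hypothesis coord_inj : forall c (x y : N c), coord x =1 coord y -> x = y.
Hypothesis def_on_coords : definable on_coords.
Hypothesis edef_default : forall k, edef (fun c _ => coord (default c) k).

Lemma coord_dec_surj c (x : N c) : exists s, coord_dec s = x.
Proof.
exists (fun m => if insub m is Some i then coord x (enum_val (i : 'I_#|K|))
                 else if [pick k : K] is Some k then coord x k else g c 0%N).
apply: coord_inj => k; rewrite coord_decE asboolT.
  by rewrite valK enum_rankK.
by exists x => k'; rewrite valK enum_rankK.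
Qed.

Lemma edef_coord_dec k : edef (fun c e => coord (coord_dec e) k).
Proof.
have d1 := def_sub (fun j => j.*2) def_on_coords.
apply: (def_ext (def_or
  (def_and d1 (edef_var (enum_rank k)))
  (def_and (def_not d1) (edef_default k)))) => c e.
rewrite coord_decE -/(evens e); case: asboolP => H; tauto.
Qed.

Lemma coord_dec_eq :
  definable (fun c e => coord_dec (evens e) = coord_dec (odds e)).
Proof.
apply: (def_ext (def_forall_fin (P := fun k c e =>
  coord (coord_dec (evens e)) k = coord (coord_dec (odds e)) k) _)) => [k|c e].
  apply: (def_eq (s := elem_sort)).
    exact: (fdef_sub (s := elem_sort) (fun j => j.*2) (edef_coord_dec k)).
  exact: (fdef_sub (s := elem_sort) (fun j => j.*2.+1) (edef_coord_dec k)).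
by split=> [H|->//]; apply: coord_inj.
Qed.

Definition coord_sort : obj_sort :=
  @ObjSort N coord_dec coord_dec_surj coord_dec_eq.

(** Reduces definability of a function with values in objects to that of its
    coordinates, which are ordinary elements. *)
Lemma fdef_coordP (f : forall c, env c -> N c) :
  fdef (s := coord_sort) f <-> forall k, edef (fun c e => coord (f c e) k).
Proof.
split=> [df k|df].
  apply: (def_comp (s := coord_sort)
    (Q := fun c e x => coord x k = odds e 0%N)); last first.
    exact: (fdef_sub (s := coord_sort) (fun j => j.*2) df).
  apply: (def_ext (def_sub (fun j => if odd j then 2%N else j.+1)
     (edef_coord_dec k))) => c e /=.
  have -> // : evens (fun j => e (if odd j then 2%N else j.+1)) = odds e.
  by apply/funext => j; rewrite /evens odd_double.
apply: (def_ext (def_forall_fin (P := fun k c e =>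
  coord (f c (evens e)) k = coord (coord_dec (odds e)) k) _)) => [k|c e].
  apply: (def_eq (s := elem_sort)).
    exact: (fdef_sub (s := elem_sort) (fun j => j.*2) (df k)).
  exact: (fdef_sub (s := elem_sort) (fun j => j.*2.+1) (edef_coord_dec k)).
by split=> [H|-> //]; apply: coord_inj.
Qed.

End Coordinates.

End Definability.

Local Open Scope ring_scope.

(** * Bounded generation of the special linear groups *)

Section BoundedGeneration.
Variable n : nat.
Notation idx := ('I_n.+1 * 'I_n.+1)%type.

Section Words.
Variable F : nzRingType.
Notation mx := 'M[F]_n.+1.

Definition elem_mx (p : idx) (a : F) : mx := 1 + a *: delta_mx p.1 p.2.

(** [s] prescribes the positions of the factors and [u] their entries. *)
Fixpoint word_mx (s : seq idx) (u : nat -> F) : mx :=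
  if s is p :: s' then elem_mx p (u 0%N) * word_mx s' (fun k => u k.+1) else 1.

Lemma word_mx_cat s s' (u u' : nat -> F) :
  exists v, word_mx (s ++ s') v = word_mx s u * word_mx s' u'.
Proof.
elim: s u => [|p s IHs] u; first by exists u'; rewrite /= mul1r.
have [v Hv] := IHs (fun k => u k.+1).
by exists (fun k => if k is k'.+1 then v k' else u 0%N); rewrite /= Hv mulrA.
Qed.

Lemma word_mx_const0 s : word_mx s (fun=> 0) = 1.
Proof.
by elim: s => //= p s ->; rewrite /elem_mx scale0r addr0 mulr1.
Qed.

(** The column operations 1 + v e_j^T are the only matrices that the reduction
    multiplies by. *)
Definition col_op (j : 'I_n.+1) (v : 'I_n.+1 -> F) : mx :=
  1 + \sum_i v i *: delta_mx i j.

Lemma col_opE j v i k : col_op j v i k = (i == k)%:R + v i * (k == j)%:R.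
Proof.
rewrite !mxE summxE (bigD1 i) //= big1 ?addr0 => [|l li].
  by rewrite !mxE eqxx.
by rewrite !mxE eq_sym (negPf li) mulr0.
Qed.

Lemma mul_col_opE j v (A : mx) i k : (col_op j v * A) i k = A i k + v i * A j k.
Proof.
rewrite !mxE; under eq_bigr do rewrite col_opE mulrDl.
rewrite big_split /=; congr (_ + _).
  by rewrite (bigD1 i) //= eqxx mul1r big1 ?addr0 // => l /negPf;
    rewrite eq_sym => ->; rewrite mul0r.
by rewrite (bigD1 j) //= eqxx mulr1 big1 ?addr0 // => l /negPf ->;
  rewrite mulr0 mul0r.
Qed.

Lemma col_opN j v (A : mx) : v j = 0 ->
  col_op j v * (col_op j (fun i => - v i) * A) = A.
Proof.
move=> vj; apply/matrixP => i k; rewrite !mul_col_opE vj oppr0 mul0r addr0.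
by rewrite mulNr addrNK.
Qed.

End Words.

(** The position pattern has to be the same for all fields, as it enters a
    first-order sentence. *)
Definition boundedly_generated (X : forall F : fieldType, 'M[F]_n.+1 -> Prop) :=
  exists2 s : seq idx, all (fun p => p.1 != p.2) s &
    forall (F : fieldType) (A : 'M[F]_n.+1), X F A -> exists u, A = word_mx s u.

Notation bgen := boundedly_generated.

Lemma bgen_sub (X Y : forall F : fieldType, 'M[F]_n.+1 -> Prop) :
  (forall F A, X F A -> Y F A) -> bgen Y -> bgen X.
Proof. by move=> XY [s os Hs]; exists s => // F A /XY/Hs. Qed.

Lemma bgen_mul (X Y Z : forall F : fieldType, 'M[F]_n.+1 -> Prop) :
  (forall F A, Z F A -> exists B C, [/\ X F B, Y F C & A = B * C]) ->
  bgen X -> bgen Y -> bgen Z.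
Proof.
move=> H [s os Hs] [s' os' Hs']; exists (s ++ s'); first by rewrite all_cat os.
move=> F A /H[B [C [/Hs[u ->] /Hs'[v ->] ->]]].
by have [w Hw] := word_mx_cat s s' u v; exists w.
Qed.

Lemma bgen_one : bgen (fun F A => A = 1).
Proof. by exists [::] => // F A ->; exists (fun=> 0). Qed.

Lemma bgen_or (X Y : forall F : fieldType, 'M[F]_n.+1 -> Prop) :
  bgen X -> bgen Y -> bgen (fun F A => X F A \/ Y F A).
Proof.
move=> [s os Hs] [s' os' Hs']; exists (s ++ s'); first by rewrite all_cat os.
move=> F A [/Hs|/Hs'] [u ->].
  have [w Hw] := word_mx_cat s s' u (fun=> 0); exists w.
  by rewrite Hw word_mx_const0 mulr1.
have [w Hw] := word_mx_cat s s' (fun=> 0) u; exists w.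
by rewrite Hw word_mx_const0 mul1r.
Qed.

Lemma bgen_ex (I : finType) (X : I -> forall F : fieldType, 'M[F]_n.+1 -> Prop) :
  (forall i, bgen (X i)) -> bgen (fun F A => exists i, X i F A).
Proof.
move=> H; have D (s : seq I) : bgen (fun F A => exists2 i, i \in s & X i F A).
  elim: s => [|i s IHs]; first by exists [::] => // F A [].
  apply: bgen_sub (bgen_or (H i) IHs) => F A [j].
  by rewrite in_cons => /orP[/eqP->|js Xj]; [left|right; exists j].
by apply: bgen_sub (D (enum I)) => F A [i Xi]; exists i; rewrite ?mem_enum.
Qed.

(** The entries of a column are cleared one at a time, E_ij E_kj being zero
    for k distinct from j. *)
Lemma bgen_col_op j : bgen (fun F A => exists2 v, v j = 0 & A = col_op j v).
Proof.
have D (s : seq 'I_n.+1) : j \notin s -> bgen (fun F A =>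
    exists v, A = 1 + \sum_(i <- s) v i *: delta_mx i j).
  elim: s => [|i s IHs] /=.
    by move=> _; apply: bgen_sub bgen_one => F A [v ->]; rewrite big_nil addr0.
  rewrite in_cons negb_or => /andP[ji js].
  apply: (@bgen_mul (fun F A => exists a, A = elem_mx (i, j) a)) (IHs js).
    move=> F A [v ->]; exists (elem_mx (i, j) (v i)).
    exists (1 + \sum_(i <- s) v i *: delta_mx i j).
    split; [by exists (v i)|by exists v|].
    rewrite /elem_mx /= big_cons mulrDl mul1r mulrDr mulr1.
    rewrite mulr_sumr [X in _ + (_ + X)]big_seq [X in _ + (_ + X)]big1 ?addr0.
      by rewrite -addrA; congr (1 + _); rewrite addrC.
    move=> k ks.
    rewrite -scalerAl -scalerAr -mulmxE mul_delta_mx_0 ?scaler0 //.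
    by apply: contraNneq js => ->.
  exists [:: (i, j)] => [|F A [a ->]]; first by rewrite /= eq_sym ji.
  by exists (fun=> a); rewrite /= mulr1.
have jN : j \notin enum (predC1 j) by rewrite mem_enum inE /= eqxx.
apply: bgen_sub (D _ jN) => F A [v vj ->]; exists v; rewrite big_enum /= /col_op.
by rewrite [in LHS](bigD1 j) //= vj scale0r add0r.
Qed.

Lemma det_col_op (F : comNzRingType) j (v : 'I_n.+1 -> F) :
  v j = 0 -> \det (col_op j v) = 1.
Proof.
move=> vj; rewrite (expand_det_row _ j) (bigD1 j) //= big1 ?addr0 => [|k kj].
  rewrite col_opE eqxx vj mul0r addr0 mul1r /cofactor addnn -signr_odd odd_double.
  rewrite mul1r; have -> : row' j (col' j (col_op j v)) = 1%:M; last exact: det1.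
  apply/matrixP => i k; rewrite mxE [LHS]mxE col_opE mxE.
  by rewrite (inj_eq lift_inj) [lift j k == j]eq_sym (negPf (neq_lift _ _)) mulr0 addr0.
by rewrite col_opE eq_sym (negPf kj) vj mul0r addr0 mul0r.
Qed.

Lemma det_word_mx (F : fieldType) s (u : nat -> F) :
  all (fun p => p.1 != p.2) s -> \det (word_mx s u) = 1.
Proof.
elim: s u => [|[i j] s IHs] u /=; first by rewrite det1.
move=> /andP[ij os]; rewrite -mulmxE det_mulmx IHs // mulr1.
have -> : elem_mx (i, j) (u 0%N) = col_op j (fun k => (k == i)%:R * u 0%N).
  apply/matrixP => k l; rewrite col_opE !mxE /= mulrC; congr (_ + _).
  by case: eqP; case: eqP; rewrite ?mulr0 ?mul0r ?mulr1 ?mul1r.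
by rewrite det_col_op // eq_sym (negPf ij) mul0r.
Qed.

Definition cleared (j : nat) (F : fieldType) (A : 'M[F]_n.+1) :=
  \det A = 1 /\ forall i k : 'I_n.+1, (k < j)%N -> A i k = (i == k)%:R.

(** Otherwise column [j] would be a combination of the previous ones, which are
    unit vectors, and the determinant would vanish. *)
Lemma cleared_pivot (j : 'I_n.+1) (F : fieldType) (A : 'M[F]_n.+1) :
  cleared j A -> exists2 k : 'I_n.+1, (j <= k)%N & A k j != 0.
Proof.
move=> [dA A1]; apply: contrapT => no.
have A0 (k : 'I_n.+1) : (j <= k)%N -> A k j = 0.
  by move=> jk; apply/eqP; apply: contrapT => /negP Ak; apply: no; exists k.
pose y : 'cV[F]_n.+1 := \col_k ((k == j)%:R - (k < j)%:R * A k j).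
have Ay : A *m y = 0.
  apply/matrixP => i k0; rewrite !mxE.
  under eq_bigr do rewrite mxE mulrBr.
  rewrite sumrB (bigD1 j) //= eqxx mulr1 big1 ?addr0 => [|k /negPf->]; last first.
    by rewrite mulr0.
  have [ij|ji] := ltnP i j; last first.
    rewrite A0 // sub0r big1 ?oppr0 // => k _.
    case: ltnP => kj; last by rewrite mul0r mulr0.
    by rewrite A1 // (_ : i == k = false) ?mul0r // -val_eqE gtn_eqF // (leq_trans kj).
  rewrite (bigD1 i) //= ij mul1r (A1 i i) // eqxx mul1r big1 ?addr0 ?subrr // => k ki.
  case: ltnP => kj; last by rewrite mul0r mulr0.
  by rewrite (A1 i k) // eq_sym (negPf ki) mul0r.
have uA : A \in unitmx by rewrite unitmxE dA unitr1.
have /(congr1 (mulmx (invmx A))) := Ay.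
rewrite mulKmx // mulmx0 => /matrixP/(_ j 0); rewrite !mxE eqxx ltnn mul0r subr0.
by move/eqP; rewrite oner_eq0.
Qed.

Lemma cleared_col_op (j : nat) (k : 'I_n.+1) (F : fieldType) (A : 'M[F]_n.+1) v :
  (j <= k)%N -> v k = 0 -> cleared j A -> cleared j (col_op k v * A).
Proof.
move=> jk vk [dA A1]; split=> [|i l lj].
  by rewrite -mulmxE det_mulmx det_col_op // mul1r.
rewrite mul_col_opE A1 // A1 // (_ : k == l = false) ?mulr0 ?addr0 //.
by rewrite -val_eqE gtn_eqF // (leq_trans lj).
Qed.

(** Rows cannot be rescaled with determinant 1. Instead a nonzero entry is created
    below the pivot, in row [t], and adding a multiple of that row turns the pivot
    into 1. *)
Lemma cleared_step (j t : 'I_n.+1) (F : fieldType) (A : 'M[F]_n.+1) :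
  (j < t)%N -> cleared j A ->
  exists (k : 'I_n.+1) (v w z : 'I_n.+1 -> F) (B : 'M[F]_n.+1),
  [/\ v k = 0, w t = 0, z j = 0, cleared j.+1 B &
      A = col_op k v * (col_op t w * (col_op j z * B))].
Proof.
move=> jt cA.
have tj : t == j = false by rewrite -val_eqE gtn_eqF.
have [k [v [jk vk cA1 A1t]]] : exists (k : 'I_n.+1) (v : 'I_n.+1 -> F),
    [/\ (j <= k)%N, v k = 0, cleared j (col_op k v * A) & (col_op k v * A) t j != 0].
  have [At|At] := eqVneq (A t j) 0; last first.
    exists j, (fun=> 0); split=> //; first by apply: cleared_col_op.
    by rewrite mul_col_opE mul0r addr0.
  have [k jk Ak] := cleared_pivot cA.
  have kt : t == k = false by apply: contraNF Ak => /eqP <-; rewrite At.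
  exists k, (fun i => (i == t)%:R).
  have vk : (k == t)%:R = 0 :> F by rewrite eq_sym kt.
  split=> //; first exact: cleared_col_op.
  by rewrite mul_col_opE At eqxx mul1r add0r.
set A1 := col_op k v * A in cA1 A1t.
pose b := (1 - A1 j j) / A1 t j.
pose w i := (i == j)%:R * b.
have wt : w t = 0 by rewrite /w tj mul0r.
have cA2 : cleared j (col_op t w * A1) by apply: cleared_col_op => //; exact: ltnW.
have A2j : (col_op t w * A1) j j = 1.
  by rewrite mul_col_opE /w eqxx mul1r /b divfK // addrC subrK.
set A2 := col_op t w * A1 in cA2 A2j.
pose z i := (i != j)%:R * - A2 i j.
have zj : z j = 0 by rewrite /z eqxx mul0r.
have cA3 : cleared j.+1 (col_op j z * A2).
  have [dA3 H] := cleared_col_op (leqnn j) zj cA2.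
  split=> // i l; rewrite ltnS leq_eqVlt => /orP[/eqP lj|]; last exact: H.
  have -> : l = j by exact: val_inj.
  rewrite mul_col_opE A2j mulr1 /z; case: eqP => [->|_]; last by rewrite mul1r subrr.
  by rewrite mul0r addr0 A2j.
exists k, (fun i => - v i), (fun i => - w i), (fun i => - z i), (col_op j z * A2).
have NN (f : 'I_n.+1 -> F) : (fun i => - - f i) = f by apply/funext => i; rewrite opprK.
have K l f (X : 'M[F]_n.+1) : f l = 0 -> col_op l (fun i => - f i) * (col_op l f * X) = X.
  by move=> fl; rewrite -{2}(NN f) col_opN // fl oppr0.
by split; rewrite ?vk ?wt ?zj ?oppr0 // !K.
Qed.

(** In the last column the pivot is 1 because the determinant is. *)
Lemma cleared_last (F : fieldType) (A : 'M[F]_n.+1) :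
  cleared n A -> exists2 v, v ord_max = 0 & A = col_op ord_max v.
Proof.
move=> [dA A1].
have An : A ord_max ord_max = 1.
  rewrite -dA -det_tr det_trig; last first.
    apply/is_trig_mxP => i k ik; rewrite mxE A1; last first.
      by rewrite (leq_trans ik) // -ltnS.
    by rewrite -val_eqE gtn_eqF.
  rewrite (bigD1 ord_max) //= mxE big1 ?mulr1 // => i imax.
  rewrite mxE A1 ?eqxx // ltn_neqAle -ltnS ltn_ord andbT.
  by apply: contraNneq imax => iv; apply/eqP/val_inj.
exists (fun i => (i != ord_max)%:R * A i ord_max); first by rewrite eqxx mul0r.
apply/matrixP => i k; rewrite col_opE.
have [->|kmax] := eqVneq k ord_max.
  by have [->|imax] := eqVneq i ord_max; rewrite /= ?An ?mul0r ?addr0 ?mul1r ?mulr1 ?add0r.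
rewrite mulr0 addr0 A1 // ltn_neqAle -ltnS ltn_ord andbT.
by apply: contraNneq kmax => iv; apply/eqP/val_inj.
Qed.

Theorem SL_bounded_generation : boundedly_generated (fun F A => \det A = 1).
Proof.
suff H (j : nat) : (j <= n)%N -> bgen (cleared (n - j)).
  by apply: bgen_sub (H n (leqnn n)) => F A dA; split=> // i k; rewrite subnn.
elim: j => [_|j IHj jn].
  apply: bgen_sub (bgen_col_op ord_max) => F A; rewrite subn0; exact: cleared_last.
have lt1 : (n - j.+1 < n.+1)%N by rewrite ltnS leq_subr.
have e1 : (n - j = (n - j.+1).+1)%N by rewrite subnSK.
have lt2 : (n - j < n.+1)%N by rewrite ltnS leq_subr.
pose J := Ordinal lt1; pose T := Ordinal lt2.
have JT : (J < T)%N by rewrite /= e1.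
have {}IHj := IHj (ltnW jn); rewrite e1 in IHj.
have H1 : bgen (fun F A => exists z B,
    [/\ z J = 0, cleared J.+1 B & A = col_op J z * B]).
  apply: bgen_mul (bgen_col_op J) IHj => F A [z [B [zJ cB ->]]].
  by exists (col_op J z), B; split=> //; exists z.
have H2 : bgen (fun F A => exists w z B,
    [/\ w T = 0, z J = 0, cleared J.+1 B & A = col_op T w * (col_op J z * B)]).
  apply: bgen_mul (bgen_col_op T) H1 => F A [w [z [B [wT zJ cB ->]]]].
  exists (col_op T w), (col_op J z * B); split=> //; first by exists w.
  by exists z, B.
apply: bgen_mul (bgen_ex bgen_col_op) H2 => F A /(cleared_step JT).
move=> [k [v [w [z [B [vk wT zJ cB ->]]]]]].
exists (col_op k v), (col_op T w * (col_op J z * B)); split=> //.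
  by exists k, v.
by exists w, z, B.
Qed.

End BoundedGeneration.

(** * Double centralizers of involutions *)

Section DoubleCentralizer.
Variables (n : nat) (R : numFieldType).
Notation mx := 'M[R]_n.+1.
Implicit Types (d h k p x y : mx).

Lemma unitmx_shift x : exists c : R, x + c%:M \in unitmx.
Proof.
pose p := char_poly x.
have pN0 : p != 0 by rewrite monic_neq0 // char_poly_monic.
pose rs := [seq (i%:R : R) | i <- iota 0 (size p)].
have urs : uniq rs by rewrite map_inj_uniq ?iota_uniq //; exact: mulrIn (oner_neq0 _).
have : ~~ all (root p) rs.
  apply/negP => ars; have := max_poly_roots pN0 ars urs.
  by rewrite size_map size_iota ltnn.
case/allPn => c _ cNroot; exists (- c).
rewrite -row_free_unit -kermx_eq0; move: cNroot.
rewrite /p -eigenvalue_root_char /eigenvalue /eigenspace negbK.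
by rewrite (raddfN (scalar_mx (n := n.+1))).
Qed.

(** Testing against the matrix units shows that the entries of [k] and [p] are
    proportional. *)
Lemma sandwich_scalar k p : p != 0 ->
  (forall x, k * x * p = p * x * k) -> exists a, k = a *: p.
Proof.
move=> /eqP pN0 H.
have [j [b pjb]] : exists j b, p j b != 0.
  apply: contrapT => no; apply: pN0; apply/matrixP => i j; rewrite mxE.
  by apply/eqP; apply: contrapT => /negP ?; apply: no; exists i, j.
have E x y (a i : 'I_n.+1) : (x * delta_mx i j * y) a b = x a i * y j b.
  rewrite -mulmxE mxE (bigD1 j) //= big1 ?addr0 => [|l lj].
    rewrite mxE (bigD1 i) //= big1 ?addr0 => [|l li].
      by rewrite mxE !eqxx mulr1.
    by rewrite mxE (negPf li) mulr0.
  rewrite mxE big1 ?mul0r // => m _.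
  by rewrite mxE (negPf lj) andbF mulr0.
exists (k j b / p j b); apply/matrixP => a i; rewrite mxE.
apply: (mulIf pjb); rewrite -E H E mulrAC divfK // mulrC.
by [].
Qed.

(** The projections onto the eigenspaces of an involution [d]. They are locked, as
    rewriting with laws about scaling would otherwise look inside them. *)
Definition proj_plus d : mx := locked (2%:R^-1 *: (1 + d)).
Definition proj_minus d : mx := locked (2%:R^-1 *: (1 - d)).

Lemma proj_plusE d : proj_plus d = 2%:R^-1 *: (1 + d).
Proof. by rewrite /proj_plus -lock. Qed.

Lemma proj_minusE d : proj_minus d = 2%:R^-1 *: (1 - d).
Proof. by rewrite /proj_minus -lock. Qed.

Variable d : mx.
Hypothesis dd : d * d = 1.
Notation P := (proj_plus d).
Notation Q := (proj_minus d).

Lemma two_neq0 : 2%:R != 0 :> R. Proof. by rewrite pnatr_eq0. Qed.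

Lemma proj_sum : P + Q = 1.
Proof.
rewrite proj_plusE proj_minusE -scalerDr addrACA subrr addr0 -mulr2n -scaler_nat scalerA.
by rewrite mulVf ?two_neq0 // scale1r.
Qed.

Lemma proj_diff : P - Q = d.
Proof.
rewrite proj_plusE proj_minusE -scalerBr opprB addrC addrA subrK -mulr2n -scaler_nat scalerA.
by rewrite mulVf ?two_neq0 // scale1r.
Qed.

Lemma proj_pm : P * Q = 0.
Proof.
by rewrite proj_plusE proj_minusE -scalerAl -scalerAr mulrDl !mulrBr !mul1r mulr1 dd addrA subrK subrr !scaler0.
Qed.

Lemma proj_mp : Q * P = 0.
Proof.
by rewrite proj_plusE proj_minusE -scalerAl -scalerAr mulrBl !mulrDr !mul1r mulr1 dd [d + 1]addrC subrr !scaler0.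
Qed.

Lemma proj_pp : P * P = P.
Proof. by rewrite -[RHS]mulr1 -proj_sum mulrDr proj_pm addr0. Qed.

Lemma proj_mm : Q * Q = Q.
Proof. by rewrite -[RHS]mulr1 -proj_sum mulrDr proj_mp add0r. Qed.

(** Testing commutation against all block diagonal matrices forces a scalar on
    each eigenspace; adding a scalar makes the test matrices invertible. *)
Lemma double_centralizer_invol h :
  (forall y, y \in unitmx -> y * d = d * y -> h * y = y * h) ->
  exists a b, h = a *: P + b *: Q.
Proof.
move=> H.
have cP : P * d = P by rewrite -{2}proj_diff mulrBr proj_pp proj_pm subr0.
have cP' : d * P = P by rewrite -{1}proj_diff mulrBl proj_pp proj_mp subr0.
have cQ : Q * d = - Q by rewrite -{2}proj_diff mulrBr proj_mp proj_mm sub0r.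
have cQ' : d * Q = - Q by rewrite -{1}proj_diff mulrBl proj_pm proj_mm sub0r.
have HX x : h * (P * x * P + Q * x * Q) = (P * x * P + Q * x * Q) * h.
  have [c uc] := unitmx_shift (P * x * P + Q * x * Q).
  have cC y : c%:M * y = y * c%:M by rewrite -!mulmxE scalar_mxC.
  have := H _ uc; rewrite [h * (_ + c%:M)]mulrDr [(_ + c%:M) * h]mulrDl cC => H1.
  have /H1 : (P * x * P + Q * x * Q + c%:M) * d = d * (P * x * P + Q * x * Q + c%:M).
    rewrite mulrDl mulrDr cC; congr (_ + _).
    by rewrite mulrDl mulrDr -!mulrA cP cQ !mulrA cP' cQ' mulrN !mulNr.
  exact: addIr.
have HP x : h * (P * x * P) = P * x * P * h.
  have := HX (P * x * P); suff -> : P * (P * x * P) * P + Q * (P * x * P) * Q =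
    P * x * P by [].
  by rewrite !mulrA proj_mp !mul0r addr0 proj_pp -mulrA proj_pp.
have HQ x : h * (Q * x * Q) = Q * x * Q * h.
  have := HX (Q * x * Q); suff -> : P * (Q * x * Q) * P + Q * (Q * x * Q) * Q =
    Q * x * Q by [].
  by rewrite !mulrA proj_pm !mul0r add0r proj_mm -mulrA proj_mm.
have hP : h * P = P * h by have := HP 1; rewrite mulr1 proj_pp.
have hQ : h * Q = Q * h by have := HQ 1; rewrite mulr1 proj_mm.
have [a Ha] : exists a, h * P = a *: P.
  have [->|PN0] := eqVneq P 0; first by exists 0; rewrite mulr0 scale0r.
  apply: sandwich_scalar => // x; rewrite hP !mulrA.
  by rewrite -[P * x * P * h]HP -hP !mulrA.
have [b Hb] : exists b, h * Q = b *: Q.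
  have [->|QN0] := eqVneq Q 0; first by exists 0; rewrite mulr0 scale0r.
  apply: sandwich_scalar => // x; rewrite hQ !mulrA.
  by rewrite -[Q * x * Q * h]HQ -hQ !mulrA.
by exists a, b; rewrite -Ha -Hb -mulrDr proj_sum mulr1.
Qed.

End DoubleCentralizer.

(** * Definability in groups *)

Section GroupDefinability.
Variables (C : Type) (G : C -> groupType) (g : forall c, nat -> G c).

Notation M := (fun c => group_structure (G c)).
Notation gdef := (@edef group_sig C M g).
Notation gdefinable := (@definable group_sig C M g).

Lemma gdef_var r : gdef (fun c e => e r).
Proof. exact: (@edef_var _ _ M g). Qed.

Lemma gdef_cst k : gdef (fun c e => g c k).
Proof. exact: (@edef_cst _ _ M g). Qed.

Lemma gdef_one : gdef (fun c e => 1%g).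
Proof. by apply: (@edef_app _ _ M g GOne (fun _ c e => 1%g)) => -[]. Qed.

Lemma gdef_inv (f : forall c, (nat -> G c) -> G c) :
  gdef f -> gdef (fun c e => (f c e)^-1%g).
Proof. by move=> df; apply: (@edef_app _ _ M g GInv (fun _ => f)). Qed.

Lemma gdef_mul (f f' : forall c, (nat -> G c) -> G c) :
  gdef f -> gdef f' -> gdef (fun c e => (f c e * f' c e)%g).
Proof.
move=> df df'.
by apply: (@edef_app _ _ M g GMul
  (fun i : 'I_2 => if i == ord0 then f else f')) => i; case: ifP.
Qed.

Lemma gdef_eq (f f' : forall c, (nat -> G c) -> G c) :
  gdef f -> gdef f' -> gdefinable (fun c e => f c e = f' c e).
Proof. exact: def_eq. Qed.

Lemma gdef_all (Q : forall c, (nat -> G c) -> G c -> Prop) :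
  gdefinable (fun c e => Q c (evens e) (odds e 0%N)) ->
  gdefinable (fun c e => forall x : G c, Q c e x).
Proof. move=> dQ; exact (@def_all _ _ M g (@elem_sort _ _ M g) Q dQ). Qed.

Lemma gdef_ex (Q : forall c, (nat -> G c) -> G c -> Prop) :
  gdefinable (fun c e => Q c (evens e) (odds e 0%N)) ->
  gdefinable (fun c e => exists x : G c, Q c e x).
Proof. move=> dQ; exact (@def_ex _ _ M g (@elem_sort _ _ M g) Q dQ). Qed.

End GroupDefinability.

Ltac gdef_step := first
  [ exact: gdef_var | exact: gdef_cst | exact: gdef_one
  | apply: gdef_mul | apply: gdef_inv
  | apply: gdef_eq | apply: gdef_all | apply: gdef_ex
  | apply: def_and | apply: def_or | apply: def_iff | apply: def_imp
  | exact: def_false ].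

Ltac gdef_auto := rewrite /=; repeat (gdef_step; rewrite /=).

(** * A field inside a group *)

(** The constants name the parameters of the interpretation: the class of all
    pointed groups amounts to quantifying over them. *)
Record pointed_group := PointedGroup {
  pg_group : groupType;
  pg_const : nat -> pg_group
}.

Section Coordinatization.
Variable m : nat.
Notation n := m.+2.
Notation idx := ('I_n.+1 * 'I_n.+1)%type.

Section Raw.
Variable c : pointed_group.
Notation G := (pg_group c).
Notation g := (pg_const c).
Local Open Scope group_scope.

(** The intended values are the matrices d_1, 1 + E_01 and permutation matrices
    conjugating E_01 to E_ij. *)
Definition invol : G := g 0%N.
Definition unip : G := g 1%N.
Definition mover (p : idx) : G := g (pickle p).+2.

(** The double centralizer of the involution; for d_1 it consists of the matrices
    diag(a, b, ..., b). *)
Definition in_torus (h : G) := forall y, y * invol = invol * y -> h * y = y * h.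

Definition in_line (x : G) :=
  x = 1 \/ exists h, in_torus h /\ x = h^-1 * unip * h.

Definition moved (p : idx) (x : G) : G := mover p * x * (mover p)^-1.

Definition axis0 : 'I_n.+1 := ord0.
Definition axis1 : 'I_n.+1 := inord 1.
Definition axis2 : 'I_n.+1 := inord 2.

(** The commutator of 1 + a E_02 and 1 + b E_21 is 1 + ab E_01. *)
Definition mul_line (a b : G) : G :=
  moved (axis0, axis2) a * moved (axis2, axis1) b *
  (moved (axis0, axis2) a)^-1 * (moved (axis2, axis1) b)^-1.

(** Besides the axioms of a field on the line, the relations that, in
    GL_n over the reals, force the second parameter to be 1 + N with N of square
    zero; see [frame_nilpotent]. *)
Record frame : Prop := Frame {
  invol2 : invol * invol = 1;
  unip_inverted : invol * unip * invol = unip^-1;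
  unip2 : unip * unip <> 1;
  unip3 : unip * unip * unip <> 1;
  line_mul : forall a b, in_line a -> in_line b -> in_line (a * b);
  line_inv : forall a, in_line a -> in_line a^-1;
  line_comm : forall a b, in_line a -> in_line b -> a * b = b * a;
  line_prod : forall a b, in_line a -> in_line b -> in_line (mul_line a b);
  line_prodC : forall a b, in_line a -> in_line b -> mul_line a b = mul_line b a;
  line_prodA : forall a b d, in_line a -> in_line b -> in_line d ->
    mul_line a (mul_line b d) = mul_line (mul_line a b) d;
  line_prodDl : forall a b d, in_line a -> in_line b -> in_line d ->
    mul_line (a * b) d = mul_line a d * mul_line b d;
  line_prod1 : forall a, in_line a -> mul_line unip a = a;
  line_prodV : forall a, in_line a -> a <> 1 ->
    exists b, in_line b /\ mul_line b a = unip
}.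

Lemma in_line1 : in_line 1. Proof. by left. Qed.

Lemma in_line_unip : in_line unip.
Proof.
right; exists 1; split; first by move=> y _; rewrite mul1g mulg1.
by rewrite invg1 mul1g mulg1.
Qed.

End Raw.

Lemma def_frame : @definable group_sig pointed_group
  (fun c => group_structure (pg_group c)) pg_const (fun c _ => frame c).
Proof.
pose P c := (invol c * invol c = 1 /\
  invol c * unip c * invol c = (unip c)^-1 /\
  ~ (unip c * unip c = 1) /\
  ~ (unip c * unip c * unip c = 1) /\
  (forall a b, @in_line c a -> in_line b -> in_line (a * b)) /\
  (forall a, @in_line c a -> in_line a^-1) /\
  (forall a b, @in_line c a -> in_line b -> a * b = b * a) /\
  (forall a b, @in_line c a -> in_line b -> in_line (mul_line a b)) /\
  (forall a b, @in_line c a -> in_line b -> mul_line a b = mul_line b a) /\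
  (forall a b d, @in_line c a -> in_line b -> in_line d ->
    mul_line a (mul_line b d) = mul_line (mul_line a b) d) /\
  (forall a b d, @in_line c a -> in_line b -> in_line d ->
    mul_line (a * b) d = mul_line a d * mul_line b d) /\
  (forall a, @in_line c a -> mul_line (unip c) a = a) /\
  (forall a, @in_line c a -> ~ (a = 1) -> 
    exists b, in_line b /\ mul_line b a = unip c))%g.
apply: (def_ext (P := fun c _ => P c)) => [|c e]; last first.
  by split=> [[? [? [? [? [? [? [? [? [? [? [? [? ?]]]]]]]]]]]]|[]]; repeat split.
rewrite /P /in_line /in_torus /mul_line /moved.
gdef_auto.
Qed.

Record framed_group := FramedGroup {
  fg_pointed :> pointed_group;
  fg_frame : frame fg_pointed
}.

Section LineField.
Variable c : framed_group.
Notation G := (pg_group c).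

Record line := Line { line_val : G; _ : `[< in_line line_val >] }.

HB.instance Definition _ := [isSub for line_val].
HB.instance Definition _ := [Choice of line by <:].

Lemma lineP (x : line) : in_line (line_val x).
Proof. by apply/asboolP; exact: valP x. Qed.

Definition mk_line (x : G) (hx : in_line x) : line := Line (asboolT hx).

Let frm := fg_frame c.

Definition line_zero : line := mk_line (in_line1 _).
Definition line_one : line := mk_line (in_line_unip _).
Definition line_opp (x : line) : line := mk_line (line_inv frm (lineP x)).
Definition line_add (x y : line) : line :=
  mk_line (line_mul frm (lineP x) (lineP y)).
Definition line_mulr (x y : line) : line :=
  mk_line (line_prod frm (lineP x) (lineP y)).

Lemma line_addA : associative line_add.
Proof. by move=> x y z; apply: val_inj; rewrite /= mulgA. Qed.

Lemma line_addC : commutative line_add.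
Proof. by move=> x y; apply: val_inj; exact: line_comm (lineP x) (lineP y). Qed.

Lemma line_add0 : left_id line_zero line_add.
Proof. by move=> x; apply: val_inj; rewrite /= mul1g. Qed.

Lemma line_addN : left_inverse line_zero line_opp line_add.
Proof. by move=> x; apply: val_inj; rewrite /= mulVg. Qed.

HB.instance Definition _ :=
  GRing.isZmodule.Build line line_addA line_addC line_add0 line_addN.

Lemma line_mulrA : associative line_mulr.
Proof.
by move=> x y z; apply: val_inj; exact: line_prodA (lineP x) (lineP y) (lineP z).
Qed.

Lemma line_mulrC : commutative line_mulr.
Proof. by move=> x y; apply: val_inj; exact: line_prodC (lineP x) (lineP y). Qed.

Lemma line_mulr1 : left_id line_one line_mulr.
Proof. by move=> x; apply: val_inj; exact: line_prod1 (lineP x). Qed.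

Lemma line_mulrDl : left_distributive line_mulr +%R.
Proof.
move=> x y z; apply: val_inj.
exact: line_prodDl (lineP x) (lineP y) (lineP z).
Qed.

Lemma line_one_neq0 : line_one != 0.
Proof.
apply/eqP => /(congr1 line_val) /= u1; apply: (unip2 frm).
by rewrite u1 mulg1.
Qed.

HB.instance Definition _ := GRing.Zmodule_isComNzRing.Build line
  line_mulrA line_mulrC line_mulr1 line_mulrDl line_one_neq0.

Definition line_invr (x : line) : line :=
  if pselect (exists y : line, y * x = 1) is left h then projT1 (cid h) else 0.

Lemma line_mulVr (x : line) : x != 0 -> line_invr x * x = 1.
Proof.
move=> x0; rewrite /line_invr; case: pselect => [h|[]]; first by case: cid.
have [|y [ly yx]] := line_prodV frm (lineP x).
  by move=> x1; move/eqP: x0; apply; apply: val_inj.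
by exists (mk_line ly); apply: val_inj.
Qed.

Lemma line_invr0 : line_invr 0 = 0.
Proof.
rewrite /line_invr; case: pselect => // h; exfalso; case: h => y.
by rewrite mulr0 => /esym/eqP; rewrite oner_eq0.
Qed.

HB.instance Definition _ :=
  GRing.ComNzRing_isField.Build line line_mulVr line_invr0.

End LineField.

(** ** The field as a sort; matrices and words over it *)

Section LineSort.
Notation C := framed_group.
Notation M := (fun c : C => group_structure (pg_group c)).
Notation g := (fun c : C => pg_const c).
Notation def := (@definable group_sig C M g).
Notation gdef := (@edef group_sig C M g).
Notation env c := (nat -> pg_group (fg_pointed c)).

Definition line_coord (c : C) (x : line c) (_ : unit) : carrier (M c) := line_val x.

Lemma line_coord_inj c (x y : line c) : line_coord x =1 line_coord y -> x = y.
Proof. by move=> /(_ tt) xy; apply: val_inj. Qed.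

Lemma def_line_coords : def (@on_coords _ _ M line unit line_coord).
Proof.
have d : def (fun c e => @in_line c (e (enum_rank tt))).
  by rewrite /in_line /in_torus; gdef_auto.
apply: (def_ext d) => c e; split=> [le|[x Hx]]; first by exists (mk_line le) => -[].
by rewrite -(Hx tt); exact: lineP.
Qed.

Definition line_sort : @obj_sort _ _ M g :=
  @coord_sort _ _ M g line unit line_coord (fun c => 0) line_coord_inj
    def_line_coords (fun _ => gdef_one _).

Notation ldef := (@fdef _ _ M g line_sort).

(** An element of the field is determined by the group element carrying it. *)
Lemma ldefP (f : forall c : C, env c -> line c) :
  ldef f <-> gdef (fun c e => line_val (f c e)).
Proof. by rewrite (@fdef_coordP _ _ M g line unit line_coord); split=> [/(_ tt)|]. Qed.

Lemma ldef0 : ldef (fun c e => 0 : line c).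
Proof. by apply/ldefP; exact: gdef_one. Qed.

Lemma ldef1 : ldef (fun c e => 1 : line c).
Proof. by apply/ldefP; exact: gdef_cst. Qed.

Lemma ldefN (f : forall c : C, env c -> line c) :
  ldef f -> ldef (fun c e => - f c e).
Proof. by move=> /ldefP df; apply/ldefP; exact: gdef_inv. Qed.

Lemma ldefD (f f' : forall c : C, env c -> line c) :
  ldef f -> ldef f' -> ldef (fun c e => f c e + f' c e).
Proof. by move=> /ldefP df /ldefP df'; apply/ldefP; exact: gdef_mul. Qed.

Lemma ldefM (f f' : forall c : C, env c -> line c) :
  ldef f -> ldef f' -> ldef (fun c e => f c e * f' c e).
Proof.
move=> /ldefP df /ldefP df'; apply/ldefP.
have dm p (h : forall c : C, env c -> pg_group c) : gdef h ->
    gdef (fun c e => moved p (h c e)).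
  by move=> dh; rewrite /moved; repeat first [exact: dh|gdef_step].
by apply: gdef_mul; [apply: gdef_mul; [apply: gdef_mul|apply: gdef_inv]
  |apply: gdef_inv]; apply: dm.
Qed.

Lemma ldef_sum (I : Type) (r : seq I) (F : I -> forall c : C, env c -> line c) :
  (forall i, ldef (F i)) -> ldef (fun c e => \sum_(i <- r) F i c e).
Proof.
move=> dF; elim: r => [|i r IHr].
  by apply: (def_ext ldef0) => c e; rewrite big_nil.
by apply: (def_ext (ldefD (dF i) IHr)) => c e; rewrite big_cons.
Qed.

Lemma def_line_models (p : fo_formula ring_sig) :
  def (fun c _ => models (ring_structure (line c)) p).
Proof.
apply: (@def_models _ _ M g line_sort ring_sig
  (fun c => @interp _ (ring_structure (line c)))).
case=> fs dfs /=.
- exact: ldef0.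
- exact: ldef1.
- exact: (ldefN (dfs ord0)).
- exact: (ldefD (dfs ord0) (dfs ord_max)).
- exact: (ldefM (dfs ord0) (dfs ord_max)).
Qed.

Notation mx c := ('M[line c]_n.+1).

Definition mdef (A : forall c : C, env c -> mx c) :=
  forall i j, ldef (fun c e => A c e i j).

Lemma mdefM (A B : forall c : C, env c -> mx c) :
  mdef A -> mdef B -> mdef (fun c e => A c e * B c e).
Proof.
move=> dA dB i j.
apply: (def_ext (ldef_sum (index_enum _) (fun k => ldefM (dA i k) (dB k j)))).
by move=> c e; rewrite mxE.
Qed.

Lemma ldef_bool (b : bool) : ldef (fun c e => b%:R : line c).
Proof. by case: b; [exact: ldef1|exact: ldef0]. Qed.

Lemma mdef1 : mdef (fun c e => 1).
Proof. by move=> i j; apply: (def_ext (ldef_bool (i == j))) => c e; rewrite mxE. Qed.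

Lemma mdef_d1 : mdef (fun c e => d1_mx n.+1 (line c)).
Proof.
move=> i j; have [<-|/negPf ij] := eqVneq i j; last first.
  by apply: (def_ext ldef0) => c e; rewrite !mxE ij.
have [j0|/negPf j0] := eqVneq (i : nat) 0%N.
  by apply: (def_ext (ldefN ldef1)) => c e; rewrite !mxE eqxx j0 eqxx.
by apply: (def_ext ldef1) => c e; rewrite !mxE eqxx j0.
Qed.

Lemma mdef_word (s : seq idx) (u : forall c : C, env c -> nat -> line c) :
  (forall k, ldef (fun c e => u c e k)) -> mdef (fun c e => word_mx s (u c e)).
Proof.
elim: s u => [|p s IHs] u du /=; first exact: mdef1.
apply: mdefM; last by apply: IHs => k; exact: du.
move=> i j; apply: (def_ext (ldefD (ldef_bool (i == j))
   (ldefM (du 0%N) (ldef_bool ((i == p.1) && (j == p.2)))))) => c e.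
by rewrite !mxE.
Qed.

Definition signed_word_mx c (s : seq idx) (u : nat -> line c) (b : bool) : mx c :=
  word_mx s u * (if b then d1_mx n.+1 (line c) else 1).

Fixpoint word_gr c (s : seq idx) (u : nat -> line c) : pg_group c :=
  if s is p :: s' then
    (moved p (line_val (u 0%N)) * word_gr s' (fun k => u k.+1))%g
  else 1%g.

Definition signed_word_gr c (s : seq idx) (u : nat -> line c) (b : bool)
    : pg_group c :=
  (word_gr s u * (if b then invol c else 1))%g.

Definition central (G : groupType) (z : G) := forall y : G, (z * y = y * z)%g.

(** The first clause makes the passage from matrices to group elements a well
    defined morphism on words, the second one makes it injective, even modulo
    squares of central elements, and the third one surjective modulo them. *)
Record coordinatized (s : seq idx) (c : C) : Prop := Coordinatized {
  coord_mul : forall b b' b'' (u u' u'' : nat -> line c),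
    signed_word_mx s u b * signed_word_mx s u' b' = signed_word_mx s u'' b'' ->
    (signed_word_gr s u b * signed_word_gr s u' b' = signed_word_gr s u'' b'')%g;
  coord_ker : forall b (u : nat -> line c) z, central z ->
    signed_word_gr s u b = (z * z)%g -> signed_word_mx s u b = 1;
  coord_gen : forall x : pg_group c, exists u z, central z /\
    (x = signed_word_gr s u false * (z * z) \/
     x = signed_word_gr s u true * (z * z))%g
}.

Lemma mdef_signed_word s b (u : forall c : C, env c -> nat -> line c) :
  (forall k, ldef (fun c e => u c e k)) ->
  mdef (fun c e => signed_word_mx s (u c e) b).
Proof.
move=> du; apply: mdefM; first exact: mdef_word.
by case: b; [exact: mdef_d1|exact: mdef1].
Qed.

Lemma gdef_signed_word s b (u : forall c : C, env c -> nat -> line c) :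
  (forall k, ldef (fun c e => u c e k)) ->
  gdef (fun c e => signed_word_gr s (u c e) b).
Proof.
move=> du; apply: gdef_mul; last by case: b; [exact: gdef_cst|exact: gdef_one].
elim: s u du => [|p s IHs] u du /=; first exact: gdef_one.
apply: gdef_mul; last by apply: IHs => k; exact: du.
have /ldefP d0 := du 0%N.
by rewrite /moved; repeat first [exact: d0|gdef_step].
Qed.

Lemma mdef_eq (A B : forall c : C, env c -> mx c) :
  mdef A -> mdef B -> def (fun c e => A c e = B c e).
Proof.
move=> dA dB.
have d : def (fun c e => forall p : idx, A c e p.1 p.2 = B c e p.1 p.2).
  apply: def_forall_fin => p.
  exact: (@def_eq _ _ M g line_sort _ _ (dA p.1 p.2) (dB p.1 p.2)).
apply: (def_ext d) => c e; split=> [H|-> //]; apply/matrixP => i j; exact: (H (i, j)).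
Qed.

Lemma ldef_decs (r : nat -> nat) k :
  ldef (fun c e => decs line_sort (fun j => e (r j)) k).
Proof. exact: (@fdef_dec _ _ M g line_sort (fun j => r (pickle (k, j)))). Qed.

Lemma def_coordinatized s : def (fun c _ => coordinatized s c).
Proof.
pose P1 b b' b'' c := forall (u u' u'' : nat -> line c),
    signed_word_mx s u b * signed_word_mx s u' b' = signed_word_mx s u'' b'' ->
    (signed_word_gr s u b * signed_word_gr s u' b' = signed_word_gr s u'' b'')%g.
pose P2 b c := forall (u : nat -> line c) z, central z ->
    signed_word_gr s u b = (z * z)%g -> signed_word_mx s u b = 1.
pose P3 (c : C) := forall x : pg_group c, exists u z, central z /\
    (x = signed_word_gr s u false * (z * z) \/
     x = signed_word_gr s u true * (z * z))%g.
have d1 b b' b'' : def (fun c _ => P1 b b' b'' c).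
  rewrite /P1.
  apply: (@def_all_seq _ _ M g line_sort).
  apply: (@def_all_seq _ _ M g line_sort).
  apply: (@def_all_seq _ _ M g line_sort).
  apply: def_imp.
    apply: mdef_eq; first apply: mdefM; apply: mdef_signed_word => k;
      exact: ldef_decs.
  apply: gdef_eq; first apply: gdef_mul; apply: gdef_signed_word => k;
    exact: ldef_decs.
have d2 b : def (fun c _ => P2 b c).
  rewrite /P2 /central.
  apply: (@def_all_seq _ _ M g line_sort).
  apply: gdef_all; apply: def_imp; first by gdef_auto.
  apply: def_imp.
    apply: gdef_eq; last by gdef_auto.
    apply: gdef_signed_word => k; exact: ldef_decs.
  apply: mdef_eq; last exact: mdef1.
  apply: mdef_signed_word => k; exact: ldef_decs.
have d3 : def (fun c _ => P3 c).
  rewrite /P3 /central; apply: gdef_all.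
  apply: (@def_ex_seq _ _ M g line_sort).
  apply: gdef_ex; apply: def_and; first by gdef_auto.
  apply: def_or; (apply: gdef_eq; first exact: gdef_var);
    (apply: gdef_mul; last by gdef_auto);
    apply: gdef_signed_word => k; exact: ldef_decs.
apply: (def_ext (def_and (def_forall_fin (fun b => def_forall_fin (fun b' =>
  def_forall_fin (fun b'' => d1 b b' b'')))) (def_and (def_forall_fin d2) d3))).
move=> c _; split=> [[H1 [H2 H3]]|[H1 H2 H3]]; first by split.
by do !split.
Qed.

End LineSort.

End Coordinatization.

(** * Elementary equivalence of the groups involved *)

Lemma bijective_inj_surj (T U : Type) (f : T -> U) :
  injective f -> (forall y, exists x, f x = y) -> bijective f.
Proof.
move=> fI /choice[h hK]; exists h => // x; apply: fI; exact: hK.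
Qed.

Lemma group_iso_intro (G H : groupType) (f : G -> H) :
  {morph f : x y / (x * y)%g} -> injective f -> (forall y, exists x, f x = y) ->
  group_iso G H.
Proof.
move=> fM fI fS.
pose fm := isMultiplicative.Build G H f fM.
pose F : {multiplicative G -> H} := HB.pack f fm.
by exists F; exact: bijective_inj_surj.
Qed.

Lemma group_iso_sym (G H : groupType) : group_iso G H -> group_iso H G.
Proof.
move=> [f [h fK hK]]; apply: (@group_iso_intro _ _ h) => [x y|x y hxy|x].
- by apply: (can_inj fK); rewrite hK gmulfM !hK.
- by rewrite -(hK x) hxy hK.
- by exists (f x); rewrite fK.
Qed.

Lemma group_morphism1 (G H : groupType) (f : G -> H) :
  {morph f : x y / (x * y)%g} -> f 1%g = 1%g.
Proof. by move=> fM; apply: (mulgI (f 1%g)); rewrite -fM !mulg1. Qed.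

Lemma group_fo_morphism (G H : groupType) (f : G -> H) :
  {morph f : x y / (x * y)%g} ->
  @fo_morphism _ (group_structure G) (group_structure H) f.
Proof.
move=> fM [] a /=; [exact: group_morphism1| |exact: fM].
by apply: (mulgI (f (a ord0))); rewrite -fM !mulgV group_morphism1.
Qed.

Lemma group_iso_equiv (G H : groupType) : group_iso G H -> group_equiv G H.
Proof.
move=> [f fb]; have fM : {morph f : x y / (x * y)%g} by exact: gmulfM.
exact (@iso_elem_equiv _ (group_structure G) (group_structure H) f
  (group_fo_morphism fM) fb).
Qed.

Lemma group_equiv_prod (G H G' H' : groupType) :
  group_equiv G G' -> group_equiv H H' -> group_equiv (G * H)%type (G' * H')%type.
Proof.
have E (A B : groupType) : elem_equiv (group_structure (A * B)%type)
    (fo_prod (group_structure A) (group_structure B)).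
  apply: (@iso_elem_equiv _ (group_structure (A * B)%type)
    (fo_prod (group_structure A) (group_structure B)) id); last by exists id.
  by case.
move=> GG HH; apply: elem_equiv_trans (E _ _) _.
apply: elem_equiv_trans (elem_equiv_sym (E _ _)).
exact: elem_equiv_prod.
Qed.

Lemma gen_of_closed (G : groupType) (A : set G) :
  group_closed [pred x | `[< A x >]] -> forall x, x \in gen A <-> A x.
Proof.
move=> clA x; split=> [/asboolP H|Ax].
  by have /asboolP := H _ clA (fun y Ay => asboolT Ay).
by apply/asboolP => K _; apply.
Qed.

Section SignedSpecialLinear.
Variables (m : nat) (F : fieldType).
Notation n := m.+1.

Lemma det_d1 : \det (d1_mx n F) = -1.
Proof.
rewrite det_diag (bigD1 ord0) //= mxE /= big1 ?mulr1 // => i i_neq0.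
by rewrite mxE; case: eqP => // iv; case/eqP: i_neq0; exact: val_inj.
Qed.

Definition signed_det (A : 'M[F]_n) : Prop := \det A = 1 \/ \det A = -1.

Lemma signed_detM A B : signed_det A -> signed_det B -> signed_det (A *m B).
Proof.
by case=> dA [] dB; [left|right|right|left]; rewrite det_mulmx dA dB
  ?mulr1 ?mul1r ?mulrNN ?mulr1.
Qed.

Lemma signed_det_unit A : signed_det A -> A \in unitmx.
Proof. by rewrite unitmxE; case=> ->; rewrite ?unitrN unitr1. Qed.

(** A matrix of determinant -1 is its product with d_1, of determinant 1, times
    d_1. *)
Lemma SL_d1P (x : GL n F) :
  x \in gen (SL (n := n) (F := F) `|` [set d1 n F])%classic <->
  signed_det (GL_mx x).
Proof.
split=> [/asboolP H|].
  suff: x \in [pred y : GL n F | `[< signed_det (GL_mx y) >]] by move/asboolP.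
  apply: H.
    split=> [|y z /asboolP sy /asboolP sz]; apply/asboolP; first by left; exact: det1.
    apply: signed_detM => //=; case: sz => dz; [left|right].
      by rewrite det_inv dz invr1.
    by rewrite det_inv dz invrN invr1.
  move=> y [Sy|yd]; apply/asboolP; first by left.
  by have -> : y = d1 n F := yd; right; exact: det_d1.
move=> sx; apply/asboolP => K [K1 Kdiv] KA.
have Kd : d1 n F \in K by apply: KA; right.
have KV y : y \in K -> (y^-1)%g \in K by move=> Ky; rewrite -[(y^-1)%g]mul1g Kdiv.
have KM y z : y \in K -> z \in K -> (y * z)%g \in K.
  by move=> Ky Kz; rewrite -[z]invgK Kdiv // KV.
case: sx => dx; first by apply: KA; left.
rewrite -[x](mulgKV (d1 n F)); apply: (KM _ _ _ Kd); apply: KA; left.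
by rewrite /SL /= det_mulmx det_inv dx det_d1 invrN invr1 mulrNN mulr1.
Qed.

Definition SL_d1_mx (x : SL_d1 n F) : 'M[F]_n := GL_mx (gen_val x).

Lemma SL_d1_mx_inj : injective SL_d1_mx.
Proof. by move=> x y xy; apply: val_inj; apply: val_inj. Qed.

Lemma SL_d1_mx_det x : signed_det (SL_d1_mx x).
Proof. by apply/SL_d1P; exact: valP x. Qed.

Definition mk_SL_d1 (A : 'M[F]_n) (sA : signed_det A) : SL_d1 n F :=
  let x := MkGL (signed_det_unit sA) in
  GenGroup (gen_val := x) (proj2 (SL_d1P x) sA).

Lemma mk_SL_d1K A (sA : signed_det A) : SL_d1_mx (mk_SL_d1 sA) = A.
Proof. by []. Qed.

Lemma SL_d1_mxM (x y : SL_d1 n F) : SL_d1_mx (x * y)%g = SL_d1_mx x *m SL_d1_mx y.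
Proof. by []. Qed.

End SignedSpecialLinear.

Record pointed_field := PointedField {
  pf_field : fieldType;
  pf_const : nat -> pf_field
}.

Section SpecialLinearInterpretation.
Variable m : nat.
Notation n := m.+1.
Notation C := pointed_field.
Notation M := (fun c : C => ring_structure (pf_field c)).
Notation g := (fun c : C => pf_const c).
Notation def := (@definable ring_sig C M g).
Notation rdef := (@edef ring_sig C M g).
Notation env c := (nat -> pf_field c).
Notation idx := ('I_n * 'I_n)%type.

Lemma rdef_var r : rdef (fun c e => e r).
Proof. exact: (@edef_var _ _ M g). Qed.

Lemma rdef0 : rdef (fun c e => 0 : pf_field c).
Proof. by apply: (@edef_app _ _ M g RZero (fun _ c e => 0)) => -[]. Qed.

Lemma rdef1 : rdef (fun c e => 1 : pf_field c).
Proof. by apply: (@edef_app _ _ M g ROne (fun _ c e => 0)) => -[]. Qed.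

Lemma rdefN (f : forall c, env c -> pf_field c) :
  rdef f -> rdef (fun c e => - f c e).
Proof. by move=> df; apply: (@edef_app _ _ M g ROpp (fun _ => f)). Qed.

Lemma rdefD (f f' : forall c, env c -> pf_field c) :
  rdef f -> rdef f' -> rdef (fun c e => f c e + f' c e).
Proof.
move=> df df'.
by apply: (@edef_app _ _ M g RAdd
  (fun i : 'I_2 => if i == ord0 then f else f')) => i; case: ifP.
Qed.

Lemma rdefM (f f' : forall c, env c -> pf_field c) :
  rdef f -> rdef f' -> rdef (fun c e => f c e * f' c e).
Proof.
move=> df df'.
by apply: (@edef_app _ _ M g RMul
  (fun i : 'I_2 => if i == ord0 then f else f')) => i; case: ifP.
Qed.

Lemma rdef_sum (I : Type) (r : seq I) (f : I -> forall c, env c -> pf_field c) :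
  (forall i, rdef (f i)) -> rdef (fun c e => \sum_(i <- r) f i c e).
Proof.
move=> df; elim: r => [|i r IHr].
  by apply: (def_ext rdef0) => c e; rewrite big_nil.
by apply: (def_ext (rdefD (df i) IHr)) => c e; rewrite big_cons.
Qed.

Lemma rdef_prod (I : Type) (r : seq I) (f : I -> forall c, env c -> pf_field c) :
  (forall i, rdef (f i)) -> rdef (fun c e => \prod_(i <- r) f i c e).
Proof.
move=> df; elim: r => [|i r IHr].
  by apply: (def_ext rdef1) => c e; rewrite big_nil.
by apply: (def_ext (rdefM (df i) IHr)) => c e; rewrite big_cons.
Qed.

Lemma rdef_det (A : forall c, env c -> 'M[pf_field c]_n) :
  (forall i j, rdef (fun c e => A c e i j)) -> rdef (fun c e => \det (A c e)).
Proof.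
move=> dA; rewrite /determinant; apply: rdef_sum => s; apply: rdefM.
  case: (odd_perm s); last exact: rdef1.
  by apply: (def_ext (rdefN rdef1)) => c e; rewrite expr1.
apply: rdef_prod => i; exact: dA.
Qed.

Lemma rdef_bool (b : bool) : rdef (fun c e => b%:R : pf_field c).
Proof. by case: b; [exact: rdef1|exact: rdef0]. Qed.

Definition SL_d1_coord (c : C) (x : SL_d1 n (pf_field c)) (p : idx)
  : carrier (M c) := SL_d1_mx x p.1 p.2.

Lemma SL_d1_coord_inj c (x y : SL_d1 n (pf_field c)) :
  SL_d1_coord x =1 SL_d1_coord y -> x = y.
Proof.
by move=> xy; apply: SL_d1_mx_inj; apply/matrixP => i j; exact: (xy (i, j)).
Qed.

Lemma def_SL_d1_coords :
  def (@on_coords _ _ M (fun c => SL_d1 n (pf_field c)) idx SL_d1_coord).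
Proof.
pose A c (e : env c) := \matrix_(i, j) e (enum_rank (i, j) : nat) : 'M[pf_field c]_n.
have dA : rdef (fun c e => \det (A c e)).
  apply: rdef_det => i j.
  by apply: (def_ext (rdef_var (enum_rank (i, j)))) => c e; rewrite mxE.
have d : def (fun c e => signed_det (A c e)).
  apply: def_or.
    exact: (@def_eq _ _ M g (@elem_sort _ _ M g) _ _ dA rdef1).
  exact: (@def_eq _ _ M g (@elem_sort _ _ M g) _ _ dA (rdefN rdef1)).
apply: (def_ext d) => c e; split=> [sA|[x Hx]].
  by exists (mk_SL_d1 sA) => -[i j]; rewrite /SL_d1_coord mk_SL_d1K mxE.
have -> : A c e = SL_d1_mx x by apply/matrixP => i j; rewrite mxE -Hx.
exact: SL_d1_mx_det.
Qed.

Lemma rdef_SL_d1_one (p : idx) :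
  rdef (fun c _ => SL_d1_coord (1%g : SL_d1 n (pf_field c)) p).
Proof.
by apply: (def_ext (rdef_bool (p.1 == p.2))) => c e; rewrite /SL_d1_coord mxE.
Qed.

Definition SL_d1_sort : @obj_sort _ _ M g :=
  @coord_sort _ _ M g _ idx SL_d1_coord (fun c => 1%g) SL_d1_coord_inj
    def_SL_d1_coords rdef_SL_d1_one.

Notation sdef := (@fdef _ _ M g SL_d1_sort).

Lemma sdefP (f : forall c, env c -> SL_d1 n (pf_field c)) :
  sdef f <-> forall p, rdef (fun c e => SL_d1_coord (f c e) p).
Proof. by rewrite (@fdef_coordP _ _ M g _ idx SL_d1_coord). Qed.

Lemma sdefM (f f' : forall c, env c -> SL_d1 n (pf_field c)) :
  sdef f -> sdef f' -> sdef (fun c e => (f c e * f' c e)%g).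
Proof.
move=> /sdefP df /sdefP df'; apply/sdefP => p.
apply: (def_ext (rdef_sum (index_enum _)
  (fun k => rdefM (df (p.1, k)) (df' (k, p.2))))) => c e.
by rewrite /SL_d1_coord SL_d1_mxM mxE.
Qed.

Lemma sdef1 : sdef (fun c e => 1%g).
Proof. by apply/sdefP => p; exact: rdef_SL_d1_one. Qed.

(** The inverse is defined by an equation rather than by cofactors. *)
Lemma sdefV (f : forall c, env c -> SL_d1 n (pf_field c)) :
  sdef f -> sdef (fun c e => (f c e)^-1%g).
Proof.
move=> df.
have d1 : sdef (fun c e => (f c (evens e) * @dec _ _ M g SL_d1_sort c (odds e))%g).
  apply: sdefM; first exact: (@fdef_sub _ _ M g SL_d1_sort (fun k => k.*2) f df).
  exact: (@fdef_dec _ _ M g SL_d1_sort (fun k => k.*2.+1)).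
apply: (def_ext (@def_eq _ _ M g SL_d1_sort _ _ d1 sdef1)) => c e.
split=> [/(canRL (mulKg _))|<-]; last by rewrite mulgV.
by rewrite mulg1.
Qed.

(** The interpreted group does not depend on the constants, so that they may be
    treated as further universally quantified variables. *)
Theorem SL_d1_equiv (K L : fieldType) :
  field_equiv K L -> group_equiv (SL_d1 n K) (SL_d1 n L).
Proof.
move=> KL p _.
have [q Hq] : def (fun c _ => models (group_structure (SL_d1 n (pf_field c))) p).
  apply: (@def_models _ _ M g SL_d1_sort group_sig
    (fun c => @interp _ (group_structure (SL_d1 n (pf_field c))))).
  case=> fs dfs /=.
  - exact: sdef1.
  - exact: (sdefV (dfs ord0)).
  - exact: (sdefM (dfs ord0) (dfs ord_max)).
have E (k : fieldType) : models (ring_structure k) q <->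
    models (group_structure (SL_d1 n k)) p.
  split=> [H|H e].
    by apply/(Hq (@PointedField k (fun=> 0)) (fun=> 0)).
  have := Hq (@PointedField k (evens e)) (odds e).
  by rewrite /= mix_evens_odds => ->.
by rewrite -!E; exact: elem_equiv_models.
Qed.

End SpecialLinearInterpretation.

(** * Squares of central elements *)

Definition central_squares (G : groupType) : set G :=
  [set b | exists z, central z /\ b = (z * z)%g]%classic.

(** In GL_n over the reals these are the positive scalars: among the scalars,
    the squares are the positive ones. *)
Definition central_square_group (G : groupType) : groupType :=
  gen_group (@central_squares G).

Lemma central1 (G : groupType) : central (1%g : G).
Proof. by move=> y; rewrite mulg1 mul1g. Qed.

Lemma centralM (G : groupType) (x y : G) :
  central x -> central y -> central (x * y)%g.
Proof. by move=> cx cy z; rewrite -mulgA cy !mulgA cx. Qed.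

Lemma centralV (G : groupType) (x : G) : central x -> central (x^-1)%g.
Proof. by move=> cx z; apply: (mulgI x); rewrite mulKVg mulgA cx mulgK. Qed.

Lemma central_squares_closed (G : groupType) :
  group_closed [pred x | `[< @central_squares G x >]].
Proof.
split=> [|x y /asboolP[z [cz ->]] /asboolP[t [ct ->]]]; apply/asboolP.
  by exists 1%g; rewrite mulg1; split=> //; exact: central1.
exists (z * t^-1)%g; split; first by apply: centralM => //; exact: centralV.
by rewrite invgM -!mulgA; congr (z * _)%g; rewrite (cz (_ * _)%g) (cz t^-1%g) mulgA.
Qed.

Lemma central_squaresP (G : groupType) (x : G) :
  x \in gen (@central_squares G) <-> central_squares x.
Proof. exact: gen_of_closed (@central_squares_closed G) x. Qed.

Section CentralSquaresInterpretation.
Notation C := pointed_group.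
Notation M := (fun c : C => group_structure (pg_group c)).
Notation g := (fun c : C => pg_const c).
Notation def := (@definable group_sig C M g).
Notation gdef := (@edef group_sig C M g).
Notation B c := (central_square_group (pg_group c)).

Definition cs_coord (c : C) (x : B c) (_ : unit) : carrier (M c) := gen_val x.

Lemma cs_coord_inj c (x y : B c) : cs_coord x =1 cs_coord y -> x = y.
Proof. by move=> /(_ tt) xy; apply: val_inj. Qed.

Lemma def_cs_coords : def (@on_coords _ _ M (fun c => B c) unit cs_coord).
Proof.
have d : def (fun c e => @central_squares (pg_group c) (e (enum_rank tt))).
  by rewrite /central_squares /central; gdef_auto.
apply: (def_ext d) => c e; split=> [/central_squaresP le|[x Hx]].
  by exists (GenGroup le) => -[].
by rewrite -(Hx tt); apply/central_squaresP; exact: valP x.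
Qed.

Definition cs_sort : @obj_sort _ _ M g :=
  @coord_sort _ _ M g _ unit cs_coord (fun c => 1%g) cs_coord_inj
    def_cs_coords (fun _ => gdef_one _).

Lemma csdefP (f : forall c : C, (nat -> pg_group c) -> B c) :
  @fdef _ _ M g cs_sort f <-> gdef (fun c e => gen_val (f c e)).
Proof. by rewrite (@fdef_coordP _ _ M g _ unit cs_coord); split=> [/(_ tt)|]. Qed.

Theorem central_square_group_equiv (G H : groupType) :
  group_equiv G H -> group_equiv (central_square_group G) (central_square_group H).
Proof.
move=> GH p _.
have [q Hq] : def (fun c _ => models (group_structure (B c)) p).
  apply: (@def_models _ _ M g cs_sort group_sig
    (fun c => @interp _ (group_structure (B c)))).
  case=> fs dfs /=.
  - by apply/csdefP; exact: gdef_one.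
  - by apply/csdefP; apply: gdef_inv; apply/csdefP; exact: (dfs ord0).
  - by apply/csdefP; apply: gdef_mul; apply/csdefP;
      [exact: (dfs ord0)|exact: (dfs ord_max)].
have E (k : groupType) : models (group_structure k) q <->
    models (group_structure (central_square_group k)) p.
  split=> [H'|H' e].
    by apply/(Hq (@PointedGroup k (fun=> 1%g)) (fun=> 1%g)).
  have := Hq (@PointedGroup k (evens e)) (odds e).
  by rewrite /= mix_evens_odds => ->.
by rewrite -!E; exact: elem_equiv_models.
Qed.

End CentralSquaresInterpretation.

(** * The general linear group over the reals *)

Section RealGL.
Variables (R : realType) (m : nat).
Notation n := m.+1.
Notation G := (GL n R).
Notation mx := 'M[R]_n.

Lemma GL_mxM (x y : G) : GL_mx (x * y)%g = GL_mx x * GL_mx y.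
Proof. by []. Qed.

Lemma GL_mx1 : GL_mx (1%g : G) = 1.
Proof. by []. Qed.

Lemma GL_mx_inj (x y : G) : GL_mx x = GL_mx y -> x = y.
Proof. by move=> xy; apply: val_inj. Qed.

Lemma GL_mxVr (x : G) : GL_mx x * GL_mx x^-1%g = 1.
Proof. by rewrite -GL_mxM mulgV. Qed.

Lemma GL_mxVl (x : G) : GL_mx x^-1%g * GL_mx x = 1.
Proof. by rewrite -GL_mxM mulVg. Qed.

Lemma GL_mxV (x : G) (Y : mx) : GL_mx x * Y = 1 -> GL_mx x^-1%g = Y.
Proof. by move=> xY; rewrite -[LHS]mulr1 -xY mulrA GL_mxVl mul1r. Qed.

Lemma GL_of_inv (X Y : mx) : X * Y = 1 -> exists x : G, GL_mx x = X.
Proof. by move=> /mulmx1_unit[uX _]; exists (MkGL uX). Qed.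

Lemma centralizer_GL (d h : G) : GL_mx d * GL_mx d = 1 ->
  (forall y, y * d = d * y -> h * y = y * h)%g ->
  exists a b, GL_mx h = a *: proj_plus (GL_mx d) + b *: proj_minus (GL_mx d).
Proof.
move=> dd H; apply: double_centralizer_invol => // Y uY Yd.
have := H (MkGL uY); move=> /(_ _)/(congr1 (@GL_mx _ _)); apply.
exact: GL_mx_inj.
Qed.

(** The double centralizer of the involution 1 is the center. *)
Lemma central_GL (z : G) : central z -> exists a, GL_mx z = a%:M.
Proof.
move=> cz; have [||a [b ->]] := @centralizer_GL 1%g z.
- by rewrite GL_mx1 mulr1.
- by move=> y _; exact: cz.
exists a; rewrite GL_mx1 proj_plusE proj_minusE subrr !scaler0 addr0.
have -> : 2%:R^-1 *: (1 + 1) = 1 :> mx.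
  by rewrite -mulr2n -scaler_nat scalerA mulVf ?scale1r ?pnatr_eq0.
by rewrite -[1]/(1%:M) scalemx1.
Qed.

Lemma scalar_unit (a : R) : a != 0 -> (a%:M : mx) \in unitmx.
Proof. by move=> a0; rewrite unitmxE det_scalar unitfE expf_neq0. Qed.

Definition scalar_GL (a : R) (a0 : a != 0) : G := MkGL (scalar_unit a0).

Lemma scalar_GL_central a (a0 : a != 0) : central (scalar_GL a0).
Proof. by move=> y; apply: GL_mx_inj; rewrite !GL_mxM /= -!mulmxE scalar_mxC. Qed.

Lemma real_root (k : nat) (x : R) : 0 < x -> exists2 c, 0 < c & c ^+ k.+1 = x.
Proof.
move=> x0; pose p : {poly R} := 'X^(k.+1) - x%:P.
have [||c /andP[c0 _]] := @poly_ivt R p 0 (1 + x).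
- by rewrite addr_ge0 // ltW.
- rewrite !hornerE expr0n /= sub0r oppr_le0 (ltW x0) /=.
  rewrite subr_ge0 (le_trans _ (ler_eXnr _ _)) ?lerDl ?(ltW x0) //.
  by rewrite lerDr.
rewrite rootE !hornerE subr_eq0 => /eqP cx; exists c => //.
rewrite lt_neqAle c0 andbT; apply: contraTneq x0 => c00.
by rewrite -cx -c00 expr0n ltxx.
Qed.

Lemma polar_decomposition (x : G) : exists A c, [/\ signed_det A, 0 < c & GL_mx x = c *: A].
Proof.
have d0 : \det (GL_mx x) != 0 by have := valP x; rewrite unitmxE unitfE.
have [|c c0 cn] := @real_root m `|\det (GL_mx x)|; first by rewrite normr_gt0.
exists (c^-1 *: GL_mx x), c; split=> //; last first.
  by rewrite scalerA divff ?scale1r // gt_eqF.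
rewrite /signed_det detZ exprVn cn.
case: (ltrP (\det (GL_mx x)) 0) => [dn|dp]; [right|left].
  by rewrite ltr0_norm // invrN mulNr mulVf.
by rewrite ger0_norm // mulVf.
Qed.

(** The n-th power of [c] is 1 or -1, and [c] is positive. *)
Lemma signed_det_scalar (A : mx) (c : R) :
  signed_det A -> 0 < c -> signed_det (c *: A) -> c = 1.
Proof.
move=> sA c0; rewrite /signed_det detZ => scA.
have /eqP : c ^+ n = 1.
  have cn0 : 0 <= c ^+ n by rewrite exprn_ge0 // ltW.
  case: sA scA => ->; rewrite ?mulr1 ?mulrN1.
    case=> // cn; move: cn0; rewrite cn oppr_ge0.
    by rewrite leNgt ltr01.
  case=> cn; last exact: oppr_inj.
  by move: cn0; rewrite -oppr_le0 cn leNgt ltr01.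
by rewrite pexpr_eq1 ?(ltW c0) // => /eqP.
Qed.

Theorem GL_iso : group_iso (GL n R) (SL_d1 n R * pos_group R)%type.
Proof.
apply: group_iso_sym.
have c0 (c : pos_group R) : pos_val c != 0 by rewrite gt_eqF // (valP c).
pose f (x : SL_d1 n R * pos_group R) : G := (gen_val x.1 * scalar_GL (c0 x.2))%g.
have fE x : GL_mx (f x) = pos_val x.2 *: SL_d1_mx x.1.
  by rewrite /f GL_mxM /= -mulmxE mul_mx_scalar.
have fM : {morph f : x y / (x * y)%g}.
  move=> x y; apply: GL_mx_inj; rewrite GL_mxM !fE /= SL_d1_mxM mulmxE.
  by rewrite -scalerAl -scalerAr scalerA.
apply: (group_iso_intro (f := f) fM) => [x y fxy|y]; last first.
  have [A [c [sA cp yE]]] := polar_decomposition y.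
  exists (mk_SL_d1 sA, MkPos cp); apply: GL_mx_inj.
  by rewrite fE /= yE mk_SL_d1K.
have xyE : pos_val x.2 *: SL_d1_mx x.1 = pos_val y.2 *: SL_d1_mx y.1.
  by rewrite -!fE fxy.
have xy2 : pos_val x.2 / pos_val y.2 = 1.
  apply: (@signed_det_scalar (SL_d1_mx x.1)); first exact: SL_d1_mx_det.
    by rewrite divr_gt0 // ?(valP x.2) ?(valP y.2).
  rewrite mulrC -scalerA xyE scalerA mulVf ?c0 // scale1r.
  exact: SL_d1_mx_det.
have e2 : x.2 = y.2.
  apply: val_inj => /=; apply: (mulIf (invr_neq0 (c0 y.2))).
  by rewrite xy2 mulfV.
rewrite [x]surjective_pairing [y]surjective_pairing e2; congr (_, _).
apply: SL_d1_mx_inj; apply: (scalerI (c0 y.2)).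
by rewrite -xyE e2.
Qed.

Theorem GL_central_squares : group_iso (pos_group R) (central_square_group G).
Proof.
have c0 (c : pos_group R) : pos_val c != 0 by rewrite gt_eqF // (valP c).
have fP (c : pos_group R) :
    scalar_GL (c0 c) \in gen (@central_squares G).
  apply/central_squaresP.
  have s0 : Num.sqrt (pos_val c) != 0 by rewrite gt_eqF // sqrtr_gt0 (valP c).
  exists (scalar_GL s0); split; first exact: scalar_GL_central.
  apply: GL_mx_inj; rewrite GL_mxM /= -mulmxE -scalar_mxM -expr2 sqr_sqrtr //.
  by rewrite ltW // (valP c).
pose f (c : pos_group R) : central_square_group G := GenGroup (fP c).
apply: (group_iso_intro (f := f)) => [x y|x y /(congr1 (fun b => GL_mx (gen_val b)))|b].
- apply: val_inj; apply: GL_mx_inj; rewrite /= -scalar_mxM //.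
- move=> /= /matrixP/(_ ord0 ord0); rewrite !mxE /= !mulr1n => xy.
  exact: val_inj.
have /central_squaresP[z [cz bz]] := valP b.
have [a za] := central_GL cz.
have a0 : a != 0.
  have := valP z; rewrite /= za unitmxE det_scalar unitfE.
  by apply: contra => /eqP->; rewrite expr0n.
have aa : 0 < a ^+ 2 by rewrite exprn_even_gt0 //= a0.
exists (MkPos aa); apply: val_inj; rewrite [RHS]bz; apply: GL_mx_inj.
by rewrite GL_mxM za /= -mulmxE -scalar_mxM expr2.
Qed.

Lemma nilp_inv (N : mx) (a : R) : N * N = 0 -> (1 + a *: N) * (1 - a *: N) = 1.
Proof.
move=> NN; rewrite mulrBr mulr1 mulrDl mul1r -scalerAl -scalerAr NN !scaler0 addr0.
by rewrite addrK.
Qed.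

End RealGL.

(** * Frames of the real general linear group *)

Section Frames.
Variables (R : realType) (m : nat).
Notation n := m.+3.
Notation G := (GL n R).
Notation mx := 'M[R]_n.

Section Params.
Variable g : nat -> G.
Let c := @PointedGroup G g.
Notation d := (GL_mx (invol c)).
Notation E := (GL_mx (unip c)).
Notation P := (proj_plus d).
Notation Q := (proj_minus d).
Hypothesis dd : d * d = 1.

Lemma invol_mul_plus : d * P = P.
Proof. by rewrite -{1}(proj_diff d) mulrBl proj_pp // proj_mp // subr0. Qed.
Lemma plus_mul_invol : P * d = P.
Proof. by rewrite -{2}(proj_diff d) mulrBr proj_pp // proj_pm // subr0. Qed.
Lemma invol_mul_minus : d * Q = - Q.
Proof. by rewrite -{1}(proj_diff d) mulrBl proj_mm // proj_pm // sub0r. Qed.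
Lemma minus_mul_invol : Q * d = - Q.
Proof. by rewrite -{2}(proj_diff d) mulrBr proj_mm // proj_mp // sub0r. Qed.

Lemma torus_proj (h : G) : @in_torus c h -> exists a b, GL_mx h = a *: P + b *: Q.
Proof. by move=> th; apply: centralizer_GL. Qed.

Lemma in_torus_proj (h : G) a b : GL_mx h = a *: P + b *: Q -> @in_torus c h.
Proof.
move=> hE y /(congr1 (@GL_mx _ _)); rewrite !GL_mxM => yd; apply: GL_mx_inj.
rewrite !GL_mxM hE proj_plusE proj_minusE.
rewrite mulrDl mulrDr -!scalerAl -!scalerAr mulrDl mulrBl mulrDr mulrBr yd.
by rewrite !mul1r !mulr1.
Qed.

(** Conjugation by [a P + b Q] rescales an endomorphism that maps one eigenspace
    of the involution into the other one and kills the latter. *)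
Lemma line_nilpotent (N : mx) : N != 0 -> E = 1 + N ->
  (d * N = N /\ N * d = - N) \/ (d * N = - N /\ N * d = N) ->
  forall x : G, @in_line c x <-> exists a, GL_mx x = 1 + a *: N.
Proof.
move=> N0 EN dN x.
have [s [sP sQ sP' sQ' ss]] : exists s : bool, [/\ P * N = s%:R *: N,
    Q * N = (~~ s)%:R *: N, N * P = (~~ s)%:R *: N, N * Q = s%:R *: N & True].
  have half (Y : mx) : 2^-1 *: (Y + Y) = Y.
    by rewrite -mulr2n -scaler_nat scalerA mulVf ?scale1r ?pnatr_eq0.
  rewrite proj_plusE proj_minusE -!scalerAl -!scalerAr.
  rewrite !(mulrDl, mulrDr, mulrBl, mulrBr) !(mul1r, mulr1, mulNr, mulrN).
  case: dN => -[-> ->]; [exists true|exists false]; split=> //=;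
    by rewrite ?opprK ?half ?subrr ?scale1r ?scale0r ?scaler0.
split.
  case=> [->|[h [/torus_proj[a [b hE]] ->]]].
    by exists 0; rewrite GL_mx1 scale0r addr0.
  pose p := if s then a else b; pose q := if s then b else a.
  have hN : GL_mx h * N = p *: N.
    rewrite hE mulrDl -!scalerAl sP sQ /p.
    by case: (s); rewrite /= !scale1r !scale0r scaler0 ?addr0 ?add0r.
  have Nh : N * GL_mx h = q *: N.
    rewrite hE mulrDr -!scalerAr sP' sQ' /q.
    by case: (s); rewrite /= !scale1r !scale0r scaler0 ?addr0 ?add0r.
  have p0 : p != 0.
    apply: contraNneq N0 => p0; move: hN; rewrite p0 scale0r => hN.
    by rewrite -[N]mul1r -(GL_mxVl h) -mulrA hN mulr0.
  have hVN : GL_mx h^-1%g * N = p^-1 *: N.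
    rewrite -[N in LHS](scale1r) -(mulVf p0) -scalerA -hN -scalerAr mulrA.
    by rewrite GL_mxVl mul1r.
  exists (q / p); rewrite !GL_mxM EN mulrDr mulr1 mulrDl GL_mxVl hVN.
  by rewrite -scalerAl Nh scalerA mulrC.
move=> [a xE]; have [a0|a0] := eqVneq a 0.
  by left; apply: GL_mx_inj; rewrite xE a0 scale0r addr0.
right.
pose p := if s then 1 else a; pose q := if s then a else 1.
have p0 : p != 0 by rewrite /p; case: (s) => //; exact: oner_neq0.
have q0 : q != 0 by rewrite /q; case: (s) => //; exact: oner_neq0.
have hh : (p *: P + q *: Q) * (p^-1 *: P + q^-1 *: Q) = 1.
  rewrite mulrDl !mulrDr -!scalerAl -!scalerAr proj_pp // proj_mm //.
  rewrite proj_pm // proj_mp // !scaler0 addr0 add0r !scalerA !divff // !scale1r.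
  exact: proj_sum.
have [h hE] := GL_of_inv hh.
exists h; split; first exact: in_torus_proj hE.
apply: GL_mx_inj; rewrite !GL_mxM EN mulrDr mulr1 mulrDl GL_mxVl xE; congr (_ + _).
rewrite (GL_mxV (x := h) (Y := p^-1 *: P + q^-1 *: Q)) ?hE //.
have -> : (p^-1 *: P + q^-1 *: Q) * N = N.
  rewrite mulrDl -!scalerAl sP sQ /p /q.
  by case: (s); rewrite /= !scale1r !scale0r scaler0 ?addr0 ?add0r invr1 scale1r.
rewrite mulrDr -!scalerAr sP' sQ' /p /q.
by case: (s); rewrite /= !scale1r !scale0r ?scaler0 ?addr0 ?add0r.
Qed.

End Params.

Section FramedReal.
Variable g : nat -> G.
Let c := @PointedGroup G g.
Hypothesis fr : @frame m c.
Notation d := (GL_mx (invol c)).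
Notation E := (GL_mx (unip c)).
Notation P := (proj_plus d).
Notation Q := (proj_minus d).

Lemma frame_invol : d * d = 1.
Proof. by rewrite -GL_mxM (invol2 fr). Qed.
Let dd := frame_invol.

(** In block form with respect to the eigenspaces, conjugation by the torus keeps
    the diagonal blocks and rescales the others by inverse factors. The
    involution is not scalar, as it would then commute with an element that it
    inverts and whose square is not 1. *)
Lemma line_blocks (x : G) : @in_line c x -> x <> 1%g -> exists2 t : R, t != 0 &
  GL_mx x = P * E * P + Q * E * Q + (t *: (P * E * Q) + t^-1 *: (Q * E * P)).
Proof.
case=> [//|[h [/(torus_proj dd)[a [b hE]] ->]]] _.
have dE : d * E * d = GL_mx (unip c)^-1%g by rewrite -!GL_mxM (unip_inverted fr).
have nd1 (s : R) : d = s%:M -> False.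
  move=> ds; apply: (unip2 fr); apply: GL_mx_inj; rewrite GL_mxM GL_mx1.
  have dC : d * E = E * d by rewrite ds -!mulmxE scalar_mxC.
  by move: dE; rewrite dC -mulrA dd mulr1 => {1}->; rewrite GL_mxVl.
have a0 : a != 0.
  apply/eqP => a0; apply: (nd1 (-1)); rewrite -(proj_diff d).
  have P0 : P = 0.
    rewrite -[P]mul1r -(GL_mxVl h) hE a0 scale0r add0r -mulrA -scalerAl.
    by rewrite proj_mp // scaler0 mulr0.
  have := proj_sum d; rewrite P0 add0r sub0r => ->.
  by rewrite (raddfN (scalar_mx (n := n))).
have b0 : b != 0.
  apply/eqP => b0; apply: (nd1 1); rewrite -(proj_diff d).
  have Q0 : Q = 0.
    rewrite -[Q]mul1r -(GL_mxVl h) hE b0 scale0r addr0 -mulrA -scalerAl.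
    by rewrite proj_pm // scaler0 mulr0.
  by have := proj_sum d; rewrite Q0 addr0 subr0 => ->.
exists (a^-1 * b); first by rewrite mulf_neq0 ?invr_neq0.
rewrite !GL_mxM (GL_mxV (x := h) (Y := a^-1 *: P + b^-1 *: Q)); last first.
  rewrite hE mulrDl !mulrDr -!scalerAl -!scalerAr proj_pp // proj_mm //.
  rewrite proj_pm // proj_mp // !scaler0 addr0 add0r !scalerA !divff // !scale1r.
  exact: proj_sum.
rewrite hE !mulrDl !mulrDr -!scalerAl -!scalerAr !scalerA.
rewrite mulVf // mulVf // !scale1r invfM invrK [b^-1 * a]mulrC.
by rewrite [(a / b) *: _ + _]addrC addrACA.
Qed.

(** Conjugation by the involution separates block diagonal from block
    antidiagonal matrices. *)
Lemma parity_split (x y x' y' : mx) : d * x * d = x -> d * x' * d = x' ->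
  d * y * d = - y -> d * y' * d = - y' -> x + y = x' + y' -> x = x' /\ y = y'.
Proof.
move=> dx dx' dy dy' e.
have e' : x - y = x' - y'.
  by rewrite -dx -dx' -dy -dy' -!mulrDl -!mulrDr e.
have dbl (u v : mx) : u + u = v + v -> u = v.
  move=> uv; apply: (scalerI (two_neq0 R)).
  by rewrite !scaler_nat !mulr2n.
have xx : x = x'.
  apply: dbl; transitivity ((x + y) + (x - y)).
    by rewrite addrACA subrr addr0.
  by rewrite e e' addrACA subrr addr0.
by split=> //; move: e; rewrite xx => /addrI.
Qed.

(** Let S and O be the block diagonal and antidiagonal parts of the unipotent E,
    with blocks b and e of O. That E is inverted gives S^2 - O^2 = 1. The squares
    and cubes of E lie on the line, so their diagonal part is S again, while O is
    replaced by O_t = t b + t^-1 e; comparing, O_t O = O^2, which forces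
    be = eb = 0 as t = 1 would give E^2 = E. Then S^2 = S and S^2 = 1, so S = 1,
    and 2 O = O_t leaves only one of b and e. *)
Lemma frame_nilpotent : exists N : mx, [/\ N * N = 0, N != 0, E = 1 + N &
  (d * N = N /\ N * d = - N) \/ (d * N = - N /\ N * d = N)].
Proof.
have [dP Pd dQ Qd] := And4 (invol_mul_plus dd) (plus_mul_invol dd)
  (invol_mul_minus dd) (minus_mul_invol dd).
have [pp mm pm mp] := And4 (proj_pp dd) (proj_mm dd) (proj_pm dd) (proj_mp dd).
have [S SE] : exists S : mx, S = P * E * P + Q * E * Q by eexists.
have [b bE] : exists b : mx, b = P * E * Q by eexists.
have [e eE] : exists e : mx, e = Q * E * P by eexists.
have EE : E = S + (b + e).
  rewrite -[LHS]mul1r -[LHS]mulr1 -(proj_sum d) !mulrDl !mulrDr SE bE eE.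
  by rewrite [Q * E * P + _]addrC addrACA.
have Sd : d * S * d = S.
  rewrite SE mulrDr mulrDl !mulrA dP dQ -!mulrA Pd Qd !mulrA.
  by rewrite !(mulNr, mulrN) opprK.
have bd : d * b = b /\ b * d = - b.
  by rewrite bE !mulrA dP -!mulrA Qd !mulrN.
have ed : d * e = - e /\ e * d = e.
  by rewrite eE !mulrA dQ -!mulrA Pd !mulNr.
have bb : b * b = 0 by rewrite bE !mulrA -(mulrA _ Q) mp mulr0 !mul0r.
have ee : e * e = 0 by rewrite eE !mulrA -(mulrA _ P) pm mulr0 !mul0r.
have [O OE] : exists O : R -> mx, forall t, O t = t *: b + t^-1 *: e by eexists.
have Od t : d * O t * d = - O t.
  case: bd ed => [db bd] [de ed].
  rewrite OE mulrDr mulrDl -!scalerAr -!scalerAl db de bd mulNr ed.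
  by rewrite !scalerN -opprD.
have O1 : b + e = O 1 by rewrite OE invr1 !scale1r.
have conjM (x y : mx) : d * (x * y) * d = (d * x * d) * (d * y * d).
  by rewrite !mulrA -[d * x * d * d]mulrA dd mulr1.
have ev (x y : mx) : d * x * d = x -> d * y * d = y -> d * (x * y) * d = x * y.
  by move=> hx hy; rewrite conjM hx hy.
have oo (x y : mx) : d * x * d = - x -> d * y * d = - y -> d * (x * y) * d = x * y.
  by move=> hx hy; rewrite conjM hx hy mulrNN.
have eo (x y : mx) : d * x * d = x -> d * y * d = - y -> d * (x * y) * d = - (x * y).
  by move=> hx hy; rewrite conjM hx hy mulrN.
have oe (x y : mx) : d * x * d = - x -> d * y * d = y -> d * (x * y) * d = - (x * y).
  by move=> hx hy; rewrite conjM hx hy mulNr.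
have evD (x y : mx) : d * x * d = x -> d * y * d = y -> d * (x + y) * d = x + y.
  by move=> hx hy; rewrite mulrDr mulrDl hx hy.
have odD (x y : mx) : d * x * d = - x -> d * y * d = - y ->
    d * (x + y) * d = - (x + y).
  by move=> hx hy; rewrite mulrDr mulrDl hx hy -opprD.
(* the relations between the even part [S] and the odd part [O 1] of [E] *)
have [SO SS] : S * O 1 = O 1 * S /\ S * S - O 1 * O 1 = 1.
  have h1 : E * (d * E * d) = 1.
    by rewrite -(GL_mxVr (unip c)) -(unip_inverted fr).
  have dEd : d * E * d = S - O 1 by rewrite EE mulrDr mulrDl Sd O1 Od.
  have h2 : (S * S - O 1 * O 1) + (O 1 * S - S * O 1) = 1 + 0.
    rewrite addr0 -h1 dEd EE O1 mulrDl !mulrBr addrACA [RHS]addrACA.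
    by congr (_ + _); rewrite addrC.
  have [-> /eqP] : S * S - O 1 * O 1 = 1 /\ O 1 * S - S * O 1 = 0.
    apply: parity_split h2; [|by rewrite mulr1 dd| |by rewrite mulr0 mul0r oppr0].
      by apply: evD; [exact: ev|rewrite mulrN mulNr oo].
    by apply: odD; [exact: oe|rewrite mulrN mulNr eo].
  by rewrite subr_eq0 => /eqP ->.
have Eu := in_line_unip c.
have E2 := line_mul fr Eu Eu; have E3 := line_mul fr E2 Eu.
have [t t0] := line_blocks E2 (unip2 fr).
rewrite -SE -bE -eE -OE GL_mxM => EEt.
have [s s0] := line_blocks E3 (unip3 fr).
rewrite -SE -bE -eE -OE !GL_mxM EEt => EEs.
have [S1 OO] : S * S + O 1 * O 1 = S /\ S * O 1 + O 1 * S = O t.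
  apply: parity_split; rewrite ?Sd ?Od //; [exact: evD (ev _ _ Sd Sd) (oo _ _ (Od _) (Od _))|exact: odD (eo _ _ Sd (Od _)) (oe _ _ (Od _) Sd)|].
  rewrite -EEt EE O1 mulrDl !mulrDr.
  by rewrite [O 1 * S + _]addrC addrACA.
have [S2 _] : S * S + O t * O 1 = S /\ S * O 1 + O t * S = O s.
  apply: parity_split; rewrite ?Sd ?Od //; [exact: evD (ev _ _ Sd Sd) (oo _ _ (Od _) (Od _))|exact: odD (eo _ _ Sd (Od _)) (oe _ _ (Od _) Sd)|].
  rewrite -EEs EE O1 mulrDl !mulrDr.
  by rewrite [O t * S + _]addrC addrACA.
have OtO : O t * O 1 = O 1 * O 1 by apply: (@addrI _ (S * S)); rewrite S1 S2.
have OtE r : O r * O 1 = r *: (b * e) + r^-1 *: (e * b).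
  rewrite -O1 OE mulrDl !mulrDr -!scalerAl bb ee !scaler0.
  by rewrite add0r addr0.
have [Pb Qb Pe Qe] : [/\ P * b = b, Q * b = 0, P * e = 0 & Q * e = e].
  by rewrite bE eE !mulrA pp pm mp mm !mul0r.
have tN1 : t != 1.
  apply/eqP => t1; apply: (unip2 fr); apply: GL_mx_inj; rewrite GL_mxM GL_mx1.
  have EEE : E * E = E by rewrite EEt t1 -O1 -EE.
  by rewrite EEE -[LHS]mul1r -(GL_mxVl (unip c)) -mulrA EEE GL_mxVl.
have be0 : b * e = 0.
  have := congr1 (fun X => P * X) OtO; rewrite !OtE !mulrDr -!scalerAr !mulrA Pb Pe.
  rewrite !mul0r !scaler0 !addr0 scale1r => /eqP.
  rewrite -subr_eq0 -{2}[b * e]scale1r -scalerBl scaler_eq0 subr_eq0 (negPf tN1).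
  by move/eqP.
have eb0 : e * b = 0.
  have := congr1 (fun X => Q * X) OtO; rewrite !OtE !mulrDr -!scalerAr !mulrA Qb Qe.
  rewrite !mul0r !scaler0 !add0r invr1 scale1r => /eqP.
  rewrite -subr_eq0 -{2}[e * b]scale1r -scalerBl scaler_eq0 subr_eq0 invr_eq1.
  by rewrite (negPf tN1) => /eqP.
have OO0 : O 1 * O 1 = 0 by rewrite OtE be0 eb0 !scaler0 addr0.
have SE1 : S = 1 by rewrite -S1 OO0 addr0 -SS OO0 subr0.
exists (b + e); rewrite {1 2}O1 OO0 EE SE1; split=> //.
  apply/eqP => be; apply: (unip2 fr); apply: GL_mx_inj.
  by rewrite GL_mxM EE SE1 be addr0 mulr1.
move: OO; rewrite SE1 mul1r mulr1 -O1 => OO.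
have b2 : 2%:R *: b = t *: b.
  have := congr1 (fun X => P * X) OO; rewrite OE !mulrDr -!scalerAr Pb Pe.
  by rewrite !addr0 scaler0 addr0 scaler_nat mulr2n.
have e2 : 2%:R *: e = t^-1 *: e.
  have := congr1 (fun X => Q * X) OO; rewrite OE !mulrDr -!scalerAr Qb Qe.
  by rewrite !add0r scaler0 add0r scaler_nat mulr2n.
have [e0|e0] := eqVneq e 0; first by left; rewrite e0 addr0.
right; suff -> : b = 0 by rewrite add0r.
have t2 : 2%:R = t^-1.
  by apply/eqP; rewrite -subr_eq0; have/eqP := e2; rewrite -subr_eq0 -scalerBl
    scaler_eq0 (negPf e0) orbF.
move/eqP: b2; rewrite -subr_eq0 -scalerBl scaler_eq0 -[t]invrK -t2.
case/orP => [|/eqP //]; rewrite subr_eq0 => /eqP e4.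
have : (2%:R * 2%:R == 1 :> R) by rewrite {2}e4 mulfV ?two_neq0.
by rewrite -natrM -[X in _ == X]/(1%:R) eqr_nat.
Qed.

End FramedReal.

End Frames.

(** ** The field of a frame *)

Section RealLine.
Variables (R : realType) (m : nat) (g : nat -> GL m.+3 R).
Notation n := m.+3.
Notation G := (GL n R).
Notation mx := 'M[R]_n.
Let c := @PointedGroup G g.
Hypothesis fr : @frame m c.
Let fc := FramedGroup fr.
Notation E := (GL_mx (unip c)).

Lemma nilp_add (N : mx) (a b : R) : N * N = 0 ->
  (1 + a *: N) * (1 + b *: N) = 1 + (a + b) *: N.
Proof.
move=> NN; rewrite mulrDl mul1r mulrDr mulr1 -scalerAl -scalerAr NN !scaler0 addr0.
by rewrite scalerDl -addrA [b *: N + _]addrC.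
Qed.

Lemma commutator_expand (A Y Y' : mx) (r : R) : Y * Y' = 1 ->
  (1 + r *: A) * Y * (1 - r *: A) * Y' =
  1 + (r *: (A - Y * A * Y') - (r * r) *: (A * Y * A * Y')).
Proof.
move=> YY; rewrite mulrDl mul1r -scalerAl.
rewrite [(Y + _) * (1 - _)]mulrBr mulr1 -scalerAr mulrBl -scalerAl.
rewrite [(Y + _) * Y']mulrDl YY -scalerAl -(mulrA A Y Y') YY mulr1.
rewrite [(Y + _) * A]mulrDl -scalerAl mulrDl -scalerAl.
by rewrite scalerDr scalerA opprD addrA scalerBr !addrA.
Qed.

(** A product biadditive on the line and polynomial in its first factor is
    bilinear: the quadratic term would contradict additivity. *)
Lemma real_line : exists th : {rmorphism R -> line fc},
  bijective th /\ forall a, GL_mx (line_val (th a) : G) = 1 + a *: (E - 1).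
Proof.
have [N [NN N0 EN dN]] := frame_nilpotent fr.
have lineE := line_nilpotent (frame_invol fr) N0 EN dN.
have /choice[el elE] a : exists x : G, GL_mx x = 1 + a *: N :=
  GL_of_inv (nilp_inv a NN).
have elL a : @in_line c (el a) by apply/lineE; exists a.
pose th a : line fc := @mk_line m fc (el a) (elL a).
have th_eq (a : R) (x : line fc) :
    GL_mx (line_val x : G) = 1 + a *: N -> x = th a.
  by move=> xa; apply: val_inj; apply: GL_mx_inj; rewrite xa elE.
have thI : injective th.
  move=> a b /(congr1 (fun x : line fc => GL_mx (line_val x : G))) /=; rewrite !elE.
  by move/addrI/eqP; rewrite -subr_eq0 -scalerBl scaler_eq0 (negPf N0) orbF subr_eq0
    => /eqP.
have thS (x : line fc) : exists a, th a = x.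
  by have /lineE[a xa] := lineP x; exists a; rewrite (th_eq a x).
have thD : {morph th : a b / a + b}.
  by move=> a b; apply/esym/th_eq; rewrite GL_mxM !elE nilp_add.
have th1 : th 1 = 1.
  by apply/esym/th_eq; rewrite scale1r -EN.
have thM : {morph th : a b / a * b}.
  move=> a b.
  pose p : G := mover c (axis0 m, axis2 m).
  pose y : G := @moved m c (axis2 m, axis1 m) (el b).
  have /choice[f fE] r : exists s, th s = th r * th b := thS _.
  pose A := GL_mx p * N * GL_mx p^-1%g.
  have AA : A * A = 0.
    rewrite /A !mulrA -(mulrA _ (GL_mx p^-1%g)) GL_mxVl mulr1.
    by rewrite -(mulrA _ N N) NN mulr0 mul0r.
  have movE r : GL_mx (@moved m c (axis0 m, axis2 m) (el r) : G) = 1 + r *: A.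
    rewrite /moved !GL_mxM elE mulrDr mulr1 mulrDl GL_mxVr.
    by rewrite -scalerAr -scalerAl.
  pose Y := GL_mx y; pose Y' := GL_mx y^-1%g.
  have YY : Y * Y' = 1 by exact: GL_mxVr.
  have [X XE] : exists X : mx, X = A - Y * A * Y' by eexists.
  have [Z ZE] : exists Z : mx, Z = A * Y * A * Y' by eexists.
  have key r : f r *: N = r *: X - (r * r) *: Z.
    have : GL_mx (line_val (th (f r)) : G) =
        (1 + r *: A) * Y * (1 - r *: A) * Y'.
      pose z : G := @moved m c (axis0 m, axis2 m) (el r).
      rewrite fE; have -> : (line_val (th r * th b) : G) =
        (z * y * z^-1 * y^-1)%g by [].
      have zE : GL_mx z = 1 + r *: A := movE r.
      transitivity (GL_mx z * GL_mx y * GL_mx z^-1%g * GL_mx y^-1%g); first by [].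
      rewrite zE; congr (_ * _ * _ * _).
      by apply: GL_mxV; rewrite zE nilp_inv.
    by rewrite /= elE commutator_expand // -XE -ZE => /addrI.
  have f1 : f 1 = b by apply: thI; rewrite fE th1 mul1r.
  have f2 : f 2%:R = b + b.
    by apply: thI; rewrite fE -[2%:R]/(1 + 1) !thD th1 mulrDl mul1r.
  have k1 : b *: N = X - Z by rewrite -f1 key mulr1 !scale1r.
  (* the values at 1 and 2 separate the linear from the quadratic term *)
  have Z0 : Z = 0.
    have := key 2%:R; rewrite f2 scalerDl k1 -natrM !scaler_nat addrACA mulr2n.
    move/addrI; rewrite -opprD => /oppr_inj; rewrite (mulrnDr Z 2 2) -mulr2n.
    rewrite -[LHS]addr0 => /addrI /esym /eqP.
    by rewrite -scaler_nat scaler_eq0 pnatr_eq0 => /eqP.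
  rewrite -fE; apply/esym/th_eq; rewrite /= elE key Z0 scaler0 subr0.
  by rewrite -scalerA k1 Z0 subr0.
have th0 : th 0 = 0 by apply: (addrI (th 0)); rewrite -thD !addr0.
pose a1 := GRing.isNmodMorphism.Build _ _ th (conj th0 thD).
pose a2 := GRing.isMonoidMorphism.Build _ _ th (conj th1 thM).
pose F : {rmorphism R -> line fc} := HB.pack th a1 a2.
exists F; split; first exact: bijective_inj_surj.
by move=> a; rewrite /= elE EN [1 + N]addrC addrK.
Qed.

End RealLine.

(** ** The standard frame *)

Section StandardFrame.
Variables (R : realType) (m : nat).
Notation n := m.+3.
Notation G := (GL n R).
Notation mx := 'M[R]_n.
Notation idx := ('I_n * 'I_n)%type.
Notation axis0 := (axis0 m).
Notation axis1 := (axis1 m).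
Notation axis2 := (axis2 m).

Lemma axis01 : (axis0 == axis1) = false. Proof. by rewrite -val_eqE /= inordK. Qed.
Lemma axis02 : (axis0 == axis2) = false. Proof. by rewrite -val_eqE /= inordK. Qed.
Lemma axis21 : (axis2 == axis1) = false. Proof. by rewrite -val_eqE /= !inordK. Qed.

Lemma delta_sqr (p : idx) : p.1 != p.2 -> delta_mx p.1 p.2 * delta_mx p.1 p.2 = 0 :> mx.
Proof. by move=> p12; rewrite -mulmxE mul_delta_mx_0 // eq_sym. Qed.

(** The permutation is inverted in the conjugation, hence sends [p] to (0, 1). On
    the diagonal no such matrix exists, and any value will do. *)
Lemma exists_mover (p : idx) : exists w : G, p.1 != p.2 ->
  GL_mx w * delta_mx axis0 axis1 * GL_mx w^-1%g = delta_mx p.1 p.2.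
Proof.
have [->|p12] := eqVneq p.1 p.2; first by exists 1%g.
pose p2' := tperm p.1 axis0 p.2.
pose s := (tperm p.1 axis0 * tperm p2' axis1)%g.
have p2'0 : p2' != axis0.
  apply: contra p12 => /eqP p2'0.
  by rewrite -(tpermL p.1 axis0) in p2'0; rewrite (perm_inj p2'0).
have s1 : s p.1 = axis0 by rewrite permM tpermL tpermD // eq_sym axis01.
have s2 : s p.2 = axis1 by rewrite permM tpermL.
have [w wE] : exists w : G, GL_mx w = perm_mx s by exists (MkGL (unitmx_perm R s)).
exists w => _.
rewrite (GL_mxV (x := w) (Y := perm_mx s^-1)); last first.
  by rewrite wE -mulmxE -perm_mxM mulgV perm_mx1.
rewrite wE -mulmxE -row_permE -col_permE; apply/matrixP => i j; rewrite !mxE.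
by rewrite -s1 -s2 !(inj_eq perm_inj).
Qed.

Definition std_mover (p : idx) : G := projT1 (cid (exists_mover p)).

Lemma std_moverP p : p.1 != p.2 ->
  GL_mx (std_mover p) * delta_mx axis0 axis1 * GL_mx (std_mover p)^-1%g = delta_mx p.1 p.2.
Proof. by rewrite /std_mover; case: cid. Qed.

Lemma exists_transvection (a : R) : exists x : G, GL_mx x = elem_mx (axis0, axis1) a.
Proof.
apply: (GL_of_inv (Y := elem_mx (axis0, axis1) (- a))).
by rewrite /elem_mx scaleNr nilp_inv // delta_sqr //= axis01.
Qed.

Definition transvection (a : R) : G := projT1 (cid (exists_transvection a)).
Notation el := transvection.

Lemma transvectionE a : GL_mx (el a) = 1 + a *: delta_mx axis0 axis1.
Proof. by rewrite /transvection; case: cid. Qed.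

Definition std_const (k : nat) : G :=
  if k is k'.+2 then
    if unpickle k' is Some p then std_mover p else 1%g
  else if k is 1%N then el 1 else d1 n R.

Notation c := (@PointedGroup G std_const).

Lemma std_moverE p : @mover m c p = std_mover p.
Proof. by rewrite /mover /= pickleK. Qed.

Lemma elD a b : (el a * el b)%g = el (a + b).
Proof.
apply: GL_mx_inj; rewrite GL_mxM !transvectionE nilp_add //.
by apply: (@delta_sqr (axis0, axis1)); rewrite /= axis01.
Qed.

Lemma el0 : el 0 = 1%g.
Proof. by apply: GL_mx_inj; rewrite transvectionE scale0r addr0. Qed.

Lemma elN a : (el a)^-1%g = el (- a).
Proof. by apply: (mulgI (el a)); rewrite mulgV elD subrr el0. Qed.

Lemma el_inj : injective el.
Proof.
move=> a b /(congr1 (fun x => GL_mx x axis0 axis1)); rewrite !transvectionE !mxE axis01 !eqxx.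
by rewrite !mulr1 !add0r.
Qed.

Lemma std_moved p a : p.1 != p.2 -> GL_mx (@moved m c p (el a) : G) = elem_mx p a.
Proof.
move=> p12; have -> : @moved m c p (el a) = (std_mover p * el a * (std_mover p)^-1)%g.
  by rewrite /moved std_moverE.
rewrite !GL_mxM transvectionE mulrDr mulr1 mulrDl GL_mxVr.
by rewrite -scalerAr -scalerAl std_moverP.
Qed.

Lemma std_mul_line a b : @mul_line m c (el a) (el b) = el (a * b) :> G.
Proof.
pose x : G := @moved m c (axis0, axis2) (el a).
pose y : G := @moved m c (axis2, axis1) (el b).
have xE : GL_mx x = 1 + a *: delta_mx axis0 axis2 by apply: std_moved; rewrite /= axis02.
have yE : GL_mx y = 1 + b *: delta_mx axis2 axis1 by apply: std_moved; rewrite /= axis21.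
have xV : GL_mx x^-1%g = 1 - a *: delta_mx axis0 axis2.
  apply: GL_mxV; rewrite xE nilp_inv //.
  by apply: (@delta_sqr (axis0, axis2)); rewrite /= axis02.
have yV : GL_mx y^-1%g = 1 - b *: delta_mx axis2 axis1.
  apply: GL_mxV; rewrite yE nilp_inv //.
  by apply: (@delta_sqr (axis2, axis1)); rewrite /= axis21.
apply: GL_mx_inj; transitivity (GL_mx x * GL_mx y * GL_mx x^-1%g * GL_mx y^-1%g).
  by [].
rewrite xE xV commutator_expand; last exact: GL_mxVr.
rewrite yE yV transvectionE.
have D (i j k l : 'I_n) : (delta_mx i j * delta_mx k l : mx) =
    (j == k)%:R *: delta_mx i l.
  by rewrite -mulmxE mul_delta_mx_cond; case: (j == k); rewrite ?scale1r ?scale0r.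
have xd : delta_mx axis0 axis2 * (1 + b *: delta_mx axis2 axis1) =
    delta_mx axis0 axis2 + b *: delta_mx axis0 axis1 :> mx.
  by rewrite mulrDr mulr1 -scalerAr D eqxx scale1r.
have dx : (1 + b *: delta_mx axis2 axis1) * delta_mx axis0 axis2 = delta_mx axis0 axis2 :> mx.
  by rewrite mulrDl mul1r -scalerAl D eq_sym axis01 scale0r scaler0 addr0.
have dd : delta_mx axis0 axis2 * delta_mx axis0 axis2 = 0 :> mx.
  by rewrite D eq_sym axis02 scale0r.
rewrite dx -(mulrA _ _ (delta_mx axis0 axis2)) dx dd mul0r !scaler0 subr0.
by rewrite mulrBr mulr1 -scalerAr D eqxx scale1r opprB addrCA subrr addr0 scalerA.
Qed.

Lemma std_invol : GL_mx (@invol c) * GL_mx (@invol c) = 1 :> mx.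
Proof.
rewrite /= /d1_mx -mulmxE mulmx_diag; apply/matrixP => i j; rewrite !mxE.
by case: ifP; rewrite ?mulrNN mulr1.
Qed.

Lemma std_invol_delta : (GL_mx (d1 n R) * delta_mx axis0 axis1 = - delta_mx axis0 axis1) /\
  (delta_mx axis0 axis1 * GL_mx (d1 n R) = delta_mx axis0 axis1).
Proof.
split; apply/matrixP => i j; rewrite -mulmxE /= /d1_mx ?mul_diag_mx ?mul_mx_diag !mxE.
  by have [->|_] := eqVneq i axis0; rewrite /= ?mulN1r ?mulr0 ?oppr0.
have [->|_] := eqVneq j axis1; last by rewrite andbF mul0r.
by rewrite inordK //= mulr1.
Qed.

Lemma std_in_line (x : G) : @in_line c x <-> exists a, x = el a.
Proof.
have N0 : delta_mx axis0 axis1 != 0 :> mx.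
  by apply/eqP => /matrixP/(_ axis0 axis1)/eqP; rewrite !mxE !eqxx oner_eq0.
have uE : GL_mx (@unip c) = 1 + delta_mx axis0 axis1 :> mx.
  by rewrite [LHS]transvectionE scale1r.
rewrite (line_nilpotent std_invol N0 uE); last by right; exact: std_invol_delta.
split=> -[a xE]; exists a; last by rewrite xE transvectionE.
by apply: GL_mx_inj; rewrite xE transvectionE.
Qed.

Lemma std_frame : @frame m c.
Proof.
have el_neq (k : nat) : el k.+1%:R <> 1%g.
  by rewrite -el0 => /el_inj /eqP; rewrite pnatr_eq0.
have inE a : @in_line c (el a) by apply/std_in_line; exists a.
split.
- by apply: GL_mx_inj; rewrite GL_mxM std_invol.
- have [dl dr] := std_invol_delta.
  apply: GL_mx_inj; transitivity (GL_mx (d1 n R) * GL_mx (el 1) * GL_mx (d1 n R)).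
    by [].
  rewrite [RHS](_ : _ = GL_mx (el (-1))); last by rewrite -elN.
  rewrite !transvectionE scale1r mulrDr mulr1 mulrDl dl mulNr dr std_invol.
  by rewrite scaleN1r.
- by move: (el_neq 1%N); rewrite -[2%:R]/(1 + 1) -elD.
- by move: (el_neq 2%N); rewrite (natrD _ 2 1) (natrD _ 1 1) -!elD.
- by move=> _ _ /std_in_line[a ->] /std_in_line[b ->]; rewrite elD.
- by move=> _ /std_in_line[a ->]; rewrite elN.
- by move=> _ _ /std_in_line[a ->] /std_in_line[b ->]; rewrite !elD addrC.
- by move=> _ _ /std_in_line[a ->] /std_in_line[b ->]; rewrite std_mul_line.
- by move=> _ _ /std_in_line[a ->] /std_in_line[b ->]; rewrite !std_mul_line mulrC.
- move=> _ _ _ /std_in_line[a ->] /std_in_line[b ->] /std_in_line[e ->].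
  by rewrite !std_mul_line mulrA.
- move=> _ _ _ /std_in_line[a ->] /std_in_line[b ->] /std_in_line[e ->].
  by rewrite elD !std_mul_line elD mulrDl.
- by move=> _ /std_in_line[a ->]; rewrite std_mul_line mul1r.
move=> _ /std_in_line[a ->] a1.
have a0 : a != 0 by apply/eqP => a0; apply: a1; rewrite a0 el0.
by exists (el a^-1); split=> //; rewrite std_mul_line mulVf.
Qed.

Notation fc := (FramedGroup std_frame).

Lemma map_word_mx (K L : nzRingType) (f : {rmorphism K -> L}) (s : seq idx) u :
  map_mx f (word_mx s u) = word_mx s (fun k => f (u k)).
Proof.
elim: s u => [|p s IHs] u /=; first by rewrite map_mx1.
rewrite -!mulmxE map_mxM IHs; congr (_ *m _).
by rewrite /elem_mx map_mxD map_mx1 map_mxZ map_delta_mx.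
Qed.

Lemma map_d1_mx (K L : fieldType) (f : {rmorphism K -> L}) :
  map_mx f (d1_mx n K) = d1_mx n L.
Proof.
apply/matrixP => i j; rewrite !mxE rmorphMn /=; congr (_ *+ _).
by case: ifP; rewrite ?rmorphN1 ?rmorph1.
Qed.

Lemma map_mx_inj_field (K L : fieldType) (f : {rmorphism K -> L}) (A B : 'M[K]_n) :
  map_mx f A = map_mx f B -> A = B.
Proof.
by move=> /matrixP AB; apply/matrixP => i j; have := AB i j; rewrite !mxE => /fmorph_inj.
Qed.

(** Transported along the isomorphism of the line with the reals, the matrix and
    the group element of a word are the same real matrix. *)
Lemma std_coordinatized (s : seq idx) : all (fun p => p.1 != p.2) s ->
  (forall A : mx, \det A = 1 -> exists u, A = word_mx s u) ->
  coordinatized s fc.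
Proof.
move=> os gen_s.
have [th [thB thE]] := real_line std_frame.
have {}thE a : line_val (th a) = el a :> G.
  have unipE : GL_mx (@unip c) = 1 + delta_mx axis0 axis1 :> mx.
    by rewrite [LHS]transvectionE scale1r.
  by apply: GL_mx_inj; rewrite thE transvectionE unipE [1 + delta_mx _ _]addrC addrK.
have [ht htK thK] := thB.
have uE (u : nat -> line fc) : u = (fun k => th (ht (u k))).
  by apply/funext => k; rewrite thK.
have wordE v : GL_mx (word_gr s (fun k => th (v k)) : G) = word_mx s v.
  elim: (s) (os) v => [//|p s' IHs] /= /andP[p12 os'] v.
  transitivity (GL_mx (@moved m c p (el (v 0%N)) : G) *
    GL_mx (word_gr s' (fun k => th (v k.+1)) : G)).
    by rewrite -GL_mxM thE.
  by rewrite std_moved // IHs.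
pose sw v (b : bool) : mx := word_mx s v * (if b then d1_mx n R else 1).
have swE v b : GL_mx (signed_word_gr s (fun k => th (v k)) b : G) = sw v b.
  transitivity (GL_mx (word_gr s (fun k => th (v k)) : G) *
    GL_mx (if b then d1 n R else 1%g)); first by rewrite -GL_mxM.
  by rewrite wordE /sw; case: b.
have swM v b : signed_word_mx s (fun k => th (v k)) b = map_mx th (sw v b).
  rewrite /signed_word_mx /sw -!mulmxE map_mxM map_word_mx; congr (_ *m _).
  by case: b; rewrite ?map_d1_mx ?map_mx1.
have sw_det v b : signed_det (sw v b).
  rewrite /signed_det /sw -mulmxE det_mulmx det_word_mx // mul1r.
  by case: b; [right; exact: det_d1|left; exact: det1].
split.
- move=> b b' b'' u u' u''; rewrite (uE u) (uE u') (uE u'') !swM.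
  rewrite -mulmxE -map_mxM => /map_mx_inj_field e; apply: GL_mx_inj.
  by rewrite GL_mxM !swE -e.
- move=> b u z cz; rewrite (uE u) swM => /(congr1 (fun x : G => GL_mx x)).
  rewrite swE GL_mxM; have [a ->] := central_GL cz.
  rewrite -mulmxE -scalar_mxM -expr2 => e.
  have a2 : 0 < a ^+ 2.
    rewrite exprn_even_gt0 //=; apply/eqP => a0.
    have := signed_det_unit (sw_det (ht \o u) b); rewrite [sw _ _]e a0 expr0n /=.
    by rewrite unitmxE det_scalar expr0n unitr0.
  have a21 : a ^+ 2 = 1.
    apply: (signed_det_scalar (A := 1%:M)) => //; first by left; exact: det1.
    by have sd := sw_det (fun k => ht (u k)) b; rewrite e in sd; rewrite scalemx1; exact: sd.
  by rewrite e a21 map_mx1.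
move=> x; have [A [r [sA r0 xE]]] := polar_decomposition x.
have s0 : Num.sqrt r != 0 by rewrite gt_eqF // sqrtr_gt0.
have [v [b AE]] : exists v b, A = sw v b.
  case: sA => dA; first by have [v ->] := gen_s _ dA; exists v, false; rewrite /sw mulr1.
  have [|v Av] := gen_s (A * d1_mx n R).
    by rewrite -mulmxE det_mulmx dA det_d1 mulrNN mulr1.
  exists v, true; rewrite /sw -Av -mulrA.
  by have := std_invol; rewrite /= => ->; rewrite mulr1.
exists (fun k => th (v k)), (scalar_GL m.+2 s0); split; first exact: scalar_GL_central.
have E : x = (signed_word_gr s (fun k => th (v k)) b *
    (scalar_GL m.+2 s0 * scalar_GL m.+2 s0))%g :> G.
  apply: GL_mx_inj; rewrite GL_mxM swE xE AE GL_mxM /= -!mulmxE -scalar_mxM -expr2.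
  by rewrite sqr_sqrtr ?ltW // mul_mx_scalar.
by case: b E {AE} => E; [right|left].
Qed.

End StandardFrame.

(** * Coordinatized groups *)

Section CoordinatizedIso.
Variables (m : nat) (c : framed_group m).
Notation n := m.+3.
Notation G := (pg_group c).
Variable s : seq ('I_n * 'I_n).
Hypothesis os : all (fun p => p.1 != p.2) s.
Hypothesis gen_s : forall (F : fieldType) (A : 'M[F]_n), \det A = 1 ->
  exists u, A = word_mx s u.
Hypothesis cs : coordinatized s c.

Lemma signed_word_gen (A : 'M[line c]_n) : signed_det A ->
  exists ub : (nat -> line c) * bool, A = signed_word_mx s ub.1 ub.2.
Proof.
case=> dA.
  by have [u ->] := gen_s dA; exists (u, false); rewrite /signed_word_mx mulr1.
have [|u Au] := gen_s (A := A * d1_mx n (line c)).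
  by rewrite -mulmxE det_mulmx dA det_d1 mulrNN mulr1.
exists (u, true); rewrite /signed_word_mx -Au -mulrA.
suff -> : d1_mx n (line c) * d1_mx n (line c) = 1 by rewrite mulr1.
rewrite /d1_mx -mulmxE mulmx_diag; apply/matrixP => i j; rewrite !mxE.
by case: ifP; rewrite ?mulrNN mulr1.
Qed.

Lemma signed_word_det (u : nat -> line c) b : signed_det (signed_word_mx s u b).
Proof.
rewrite /signed_det /signed_word_mx -mulmxE det_mulmx det_word_mx // mul1r.
by case: b; [right; exact: det_d1|left; exact: det1].
Qed.

(** A matrix is sent to the group element of any word representing it; the choice
    is immaterial by [coord_mul]. *)
Theorem coordinatized_iso :
  group_iso G (SL_d1 n (line c) * central_square_group G)%type.
Proof.
apply: group_iso_sym.
have /choice[w wE] (A : SL_d1 n (line c)) := signed_word_gen (SL_d1_mx_det A).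
have [W WE] : exists W : SL_d1 n (line c) -> G,
  forall A, W A = signed_word_gr s (w A).1 (w A).2 by eexists.
have WM A B : W (A * B)%g = (W A * W B)%g.
  by rewrite !WE; apply/esym/(coord_mul cs); rewrite -!wE SL_d1_mxM.
have W1 : W 1%g = 1%g.
  by apply: (mulgI (W 1%g)); rewrite -WM !mulg1.
have zC (b : central_square_group G) : central (gen_val b).
  have /central_squaresP[z [cz ->]] := valP b.
  exact: centralM.
pose f (x : SL_d1 n (line c) * central_square_group G) : G :=
  (W x.1 * gen_val x.2)%g.
have fM : {morph f : x y / (x * y)%g}.
  move=> x y.
  transitivity (W (x.1 * y.1) * (gen_val x.2 * gen_val y.2))%g; first by [].
  rewrite WM /f -!mulgA; congr (_ * _)%g.
  by rewrite [RHS]mulgA (zC x.2 (W y.1)) mulgA.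
have fker x : f x = 1%g -> x = 1%g.
  case: x => A b; rewrite /f /= => fx.
  have WA : W A = ((gen_val b)^-1)%g by apply: (mulIg (gen_val b)); rewrite fx mulVg.
  have A1 : A = 1%g.
    have /central_squaresP[z [cz bz]] := valP b.
    apply: SL_d1_mx_inj; rewrite wE.
    apply: (coord_ker cs (z := z^-1)); first exact: centralV.
    by rewrite -WE WA [gen_val b]bz invgM.
  rewrite A1; congr (_, _); apply: val_inj; move: fx.
  by rewrite A1 W1 mul1g.
apply: (group_iso_intro (f := f) fM) => [x y fxy|x].
  apply: (mulIg y^-1%g); rewrite mulgV; apply: fker.
  rewrite fM fxy -fM mulgV; rewrite /f /= W1 mul1g //.
have [u [z [cz xE]]] := coord_gen cs x.
have zP : (z * z)%g \in gen (@central_squares G).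
  by apply/central_squaresP; exists z.
have [b {}xE] : exists b, x = (signed_word_gr s u b * (z * z))%g.
  by case: xE => ->; [exists false|exists true].
exists (mk_SL_d1 (signed_word_det u b), GenGroup zP); rewrite /f xE /=.
congr (_ * _)%g; set A := mk_SL_d1 _.
rewrite -[RHS]mulg1 -W1 !WE; apply/esym/(coord_mul cs).
by rewrite -!wE mk_SL_d1K -mulmxE [SL_d1_mx 1%g](_ : _ = 1%:M) // mulmx1.
Qed.

End CoordinatizedIso.

(** * The equivalence *)

Lemma real_line_equiv (R : realType) (m : nat) (g : nat -> GL m.+3 R)
    (fr : @frame m (@PointedGroup (GL m.+3 R) g)) :
  field_equiv R (line (FramedGroup fr)).
Proof.
have [th [thB _]] := real_line fr.
apply: (@iso_elem_equiv _ (ring_structure R)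
  (ring_structure (line (FramedGroup fr))) th) thB.
case=> a /=; [exact: rmorph0|exact: rmorph1|exact: rmorphN|exact: rmorphD|exact: rmorphM].
Qed.

(** One sentence, the existence of parameters satisfying [frame] and
    [coordinatized], is transferred from GL_n(R) to [H]. Each sentence of the
    theory of the reals is transferred separately, as holding in the line of all
    frames of GL_n(R). *)
Lemma GL_equiv_decomposition (R : realType) (m : nat) (H : groupType) :
  group_equiv H (GL m.+3 R) ->
  exists (L : fieldType) (B : groupType),
    [/\ field_equiv L R, group_equiv B (pos_group R)
      & group_iso H (SL_d1 m.+3 L * B)%type].
Proof.
move=> HG.
have [s os gen_s] := SL_bounded_generation m.+2.
have [p1 Hp1] := def_frame m.
have [p2 Hp2] := def_coordinatized s.
have GH : elem_equiv (group_structure (GL m.+3 R)) (group_structure H).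
  exact: elem_equiv_sym.
pose fG := FramedGroup (std_frame R m).
have [e] : exists e : nat -> H, @holds _ (group_structure H) e (FAnd p1 p2).
  apply: (elem_equiv_satisfiable GH).
  exists (mix (@std_const R m) (fun=> 1%g)); apply/holds_FAnd; split.
    exact/(Hp1 (@PointedGroup _ (@std_const R m)))/std_frame.
  apply/(Hp2 fG)/std_coordinatized => // A dA; exact: gen_s.
rewrite -(mix_evens_odds e) holds_FAnd => -[].
move=> /(Hp1 (@PointedGroup H (evens e))) fr /(Hp2 (FramedGroup fr)) cs.
exists (line (FramedGroup fr)), (central_square_group H); split.
- apply: elem_equiv_sym; apply: (@elem_equiv_incl _ (ring_structure R)
    (ring_structure (line (FramedGroup fr))) (0 : line _) (0 : R)).
  move=> p _ Rp.
  have [q Hq] := def_line_models m p.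
  have Gq : models (group_structure (GL m.+3 R)) (FImp p1 q).
    move=> e' /=; rewrite -(mix_evens_odds e').
    move=> /(Hp1 (@PointedGroup (GL m.+3 R) (evens e'))) fr'.
    apply/(Hq (FramedGroup fr')).
    by apply/(elem_equiv_models p (real_line_equiv fr')).
  have /(elem_equiv_models _ HG)/(_ (mix (evens e) (odds e))) := Gq.
  move=> /= Hpq; apply/(Hq (FramedGroup fr) (odds e))/Hpq.
  exact/(Hp1 (@PointedGroup H (evens e))).
- apply: elem_equiv_trans (central_square_group_equiv HG) _.
  apply/elem_equiv_sym/group_iso_equiv; exact: GL_central_squares.
exact: (coordinatized_iso os (fun F A => gen_s F A) cs).
Qed.

Theorem theorem6p3 (R : realType) (n : nat) (hn : (3 <= n)%N) (H : groupType) :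
  group_equiv H (GL n R) <->
  exists (L : fieldType) (B : groupType),
    [/\ field_equiv L R,
        group_equiv B (pos_group R)
      & group_iso H (SL_d1 n L * B)%type].
Proof.
case: n hn => [|[|[|m]]] // _; split; first exact: GL_equiv_decomposition.
move=> [L [B [LR BR HLB]]].
apply: elem_equiv_trans (group_iso_equiv HLB) _.
apply: elem_equiv_trans (group_equiv_prod (SL_d1_equiv _ LR) BR) _.
apply/elem_equiv_sym/group_iso_equiv; exact: GL_iso.
Qed.
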